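(* Let the single-trajectory (Markovian-observation) Q-learning recursion be run with a constant step size $\alpha\in(0,1)$ and deterministic $Q_0$. Let $d$ be the stationary distribution of the behavior-induced chain $X_k=(s_k,a_k)$, and assume $d(s,a)>0$ for every $(s,a)$. Assume that the chain is irreducible and aperiodic, that $X_0\sim d$, and that $t_{\mathrm{mix}}\ge1$ is such that, for every integer $\ell\ge0$, $$\sup_{x\in\mathcal S\times\mathcal A}\|(P^b)^\ell(x,\cdot)-d\|_{\mathrm{TV}}\le 2^{-\lfloor\ell/t_{\mathrm{mix}}\rfloor}.$$ Fix any $\varepsilon>0$ such that $\beta_\varepsilon:=\rho(\mathcal M_\alpha)+\varepsilon<1$, and let $W_{\max}$ and $K_{\beta_\varepsilon}$ be as defined in the context. Then, for every $k\ge0$, $$\begin{aligned}\mathbb E[\|Q_k-Q^*\|_\infty]\le\;&\left(1+\frac{2\gamma d_{\max}}{d_{\min}(1-\gamma)}\right)128|\mathcal S|^2|\mathcal A|^2\sqrt{W_{\max}}\left(t_{\mathrm{mix}}\sqrt{\frac{\alpha}{d_{\min}(1-\gamma)}}+\frac{\alpha t_{\mathrm{mix}}}{d_{\min}(1-\gamma)}\right)\\&+K_{\beta_\varepsilon}\beta_\varepsilon^k\|Q_0-Q^*\|_\infty+2\alpha\gamma d_{\max}K_{\beta_\varepsilon}^2\,k\beta_\varepsilon^{k-1}\|Q_0-Q^*\|_\infty,\end{aligned}$$ where $k\beta_\varepsilon^{k-1}=0$ when $k=0$.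
   Context: MDP. A finite discounted MDP has state space $\mathcal S=\{1,\dots,|\mathcal S|\}$, action space $\mathcal A=\{1,\dots,|\mathcal A|\}$, transition probabilities $P(s'\mid s,a)$, real one-step rewards $r(s,a,s')$, and discount factor $\gamma\in(0,1)$. Put $R(s,a):=\sum_{s'}P(s'\mid s,a)r(s,a,s')$ and $R_{\max}:=\max_{s,a,s'}|r(s,a,s')|$. Q-functions are vectors $Q\in\mathbb R^{|\mathcal S||\mathcal A|}$ indexed by state-action pairs. $P$ also denotes the $(|\mathcal S||\mathcal A|)\times|\mathcal S|$ matrix whose row $(s,a)$ is $P(\cdot\mid s,a)$. A stochastic policy is a map $\mu$ from $\mathcal S$ to probability distributions on $\mathcal A$; $\Pi^\mu$ is the $|\mathcal S|\times(|\mathcal S||\mathcal A|)$ matrix with $(\Pi^\mu Q)(s)=\sum_a\mu(a\mid s)Q(s,a)$. $\Theta$ is the set of deterministic policies $\pi:\mathcal S\to\mathcal A$, identified with one-hot stochastic policies. $V_Q(s):=\max_aQ(s,a)$, $F(Q):=R+\gamma PV_Q$, and $Q^*$ is the unique fixed point of $F$. Single-trajectory Q-learning. A fixed behavior policy $b(a\mid s)$ generates $s_{k+1}\sim P(\cdot\mid s_k,a_k)$, $r_{k+1}=r(s_k,a_k,s_{k+1})$, $a_{k+1}\sim b(\cdot\mid s_{k+1})$; $X_k:=(s_k,a_k)$ is a Markov chain on $\mathcal S\times\mathcal A$ with kernel $P^b(s',a'\mid s,a):=P(s'\mid s,a)b(a'\mid s')$, also written $P^b(x,x')$. The update is $Q_{k+1}(s_k,a_k)=Q_k(s_k,a_k)+\alpha\big(r_{k+1}+\gamma\max_uQ_k(s_{k+1},u)-Q_k(s_k,a_k)\big)$,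 all other coordinates unchanged. $\|p-q\|_{\mathrm{TV}}:=\frac12\sum_x|p(x)-q(x)|$. $d_{\min}:=\min_{s,a}d(s,a)$, $d_{\max}:=\max_{s,a}d(s,a)$. Matrices. $D:=\mathrm{diag}(d(s,a))$; $M_\pi:=I-\alpha D+\alpha\gamma DP\Pi^\pi$; $\mathcal M_\alpha:=\{M_\pi:\pi\in\Theta\}$; $\mathrm{co}(\mathcal M_\alpha)$ is its convex hull. The joint spectral radius of a bounded set $\mathcal H$ of square matrices is $\rho(\mathcal H):=\lim_{k\to\infty}\sup_{A_1,\dots,A_k\in\mathcal H}\|A_k\cdots A_1\|^{1/k}$ (independent of the submultiplicative norm). Constants. $W_{\max}:=\big(R_{\max}+(1+\gamma)\max\{\|Q_0\|_\infty,\tfrac{R_{\max}}{1-\gamma}\}\big)^2$, and $$K_{\beta_\varepsilon}:=\sup_{\ell\ge0}\beta_\varepsilon^{-\ell}\sup_{M_0,\dots,M_{\ell-1}\in\mathrm{co}(\mathcal M_\alpha)}\|M_{\ell-1}\cdots M_0\|_\infty,$$ where $\|\cdot\|_\infty$ on matrices is the induced infinity norm and the product of length zero is the identity. *)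

(* Defs.v *)
From HB Require Import structures.
From mathcomp Require Import all_boot all_order all_algebra.
From mathcomp Require Import all_classical all_reals all_analysis.

Set Implicit Arguments.
Unset Strict Implicit.
Unset Printing Implicit Defensive.

Import Order.TTheory GRing.Theory Num.Theory.
Import numFieldNormedType.Exports.

Local Open Scope classical_set_scope.
Local Open Scope ring_scope.

Definition is_dist (R : realType) (T : finType) (p : T -> R) : Prop :=
  (forall x, 0 <= p x) /\ \sum_x p x = 1.

Definition tv_dist (R : realType) (T : finType) (p q : T -> R) : R :=
  2^-1 * \sum_x `|p x - q x|.

(* [K x y] is the probability of moving from x to y. *)

Section MarkovChain.
Variables (R : realType) (T : finType).
Implicit Types (K : T -> T -> R) (d : T -> R).

Fixpoint kernel_iter K (l : nat) (x y : T) : R :=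
  if l is l'.+1 then \sum_z K x z * kernel_iter K l' z y else (x == y)%:R.

Definition stationary K d : Prop :=
  is_dist d /\ forall y, \sum_x d x * K x y = d y.

Definition irreducible K : Prop := forall x y, exists l, 0 < kernel_iter K l x y.

(* The gcd of the set of return times of every state is 1, i.e. 1 is their only
   common divisor. *)
Definition aperiodic K : Prop :=
  forall (x : T) (g : nat),
    (forall l, (0 < l)%N -> 0 < kernel_iter K l x x -> (g %| l)%N) -> g = 1%N.

Definition path_event (Omega : Type) (X : nat -> Omega -> T) (x : nat -> T)
    (k : nat) : set Omega :=
  [set w | forall i, (i <= k)%N -> X i w = x i].

(* The Markov property, P(X_{k+1} = y | X_0, ..., X_k) = K(X_k, y), is stated
   multiplied out so that no conditioning on null events occurs. *)
Record markov_chain (dO : measure_display) (Omega : measurableType dO)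
    (Pr : probability Omega R) (X : nat -> Omega -> T) d K : Prop := {
  markov_measurable : forall k x, measurable [set w | X k w = x];
  markov_init : forall x, Pr [set w | X 0%N w = x] = (d x)%:E;
  markov_step : forall (x : nat -> T) k,
    Pr (path_event X x k.+1) = (Pr (path_event X x k) * (K (x k) (x k.+1))%:E)%E
}.

End MarkovChain.

Section MatrixSets.
Variables (R : realType) (n : nat).
Implicit Types (A : 'M[R]_n) (H : set 'M[R]_n) (B : nat -> 'M[R]_n).

(* On ['cV[R]_n], [`| x |] is the maximum of the absolute values of the
   entries, so this is the matrix norm induced by the infinity norm. *)
Definition norm_inf A : R := sup [set `|A *m x| | x in [set x : 'cV[R]_n | `|x| <= 1]].

(* B_{k-1} *m ... *m B_0 *)
Fixpoint left_prod B (k : nat) : 'M[R]_n :=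
  if k is k'.+1 then B k' *m left_prod B k' else 1%:M.

Definition max_prod_norm H (k : nat) : R :=
  sup [set norm_inf (left_prod B k) | B in [set B | forall i, H (B i)]].

Definition joint_spectral_radius H : R :=
  limn (fun k => sup [set norm_inf (left_prod B k) `^ (k%:R^-1)
                     | B in [set B | forall i, H (B i)]]).

Definition convex_hull H : set 'M[R]_n :=
  [set A | exists (m : nat) (c : 'I_m -> R) (B : 'I_m -> 'M[R]_n),
     [/\ is_dist c, forall i, H (B i) & A = \sum_i c i *: B i]].

Definition growth_const H (beta : R) : R :=
  sup [set beta ^- l * max_prod_norm (convex_hull H) l | l in [set: nat]].

End MatrixSets.

(* The state and action sets have nS.+1 and nA.+1 elements. *)

Section MDP.
Variables (R : realType) (nS nA : nat).
Notation S := 'I_nS.+1.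
Notation A := 'I_nA.+1.
Notation N := (nS.+1 * nA.+1)%N.

Record mdp := MDP {
  trans : S -> A -> S -> R; (* P(s'|s,a) is [trans s a s'] *)
  reward : S -> A -> S -> R;
  discount : R;
  trans_dist : forall s a, is_dist (trans s a);
  discount_gt0 : 0 < discount;
  discount_lt1 : discount < 1
}.

(* A policy mu is given by the values mu(a|s). *)
Definition is_policy (mu : S -> A -> R) : Prop := forall s, is_dist (mu s).

Definition deterministic (pi : S -> A) (s : S) (a : A) : R := (a == pi s)%:R.

(* Vectors of R^{|S||A|} are column vectors; the coordinate of the pair (s, a)
   is the one numbered [mxvec_index s a]. *)
Definition sa_vec (f : S * A -> R) : 'cV[R]_N := (mxvec (\matrix_(s, a) f (s, a)))^T.

Definition sa_get (Q : 'cV[R]_N) (x : S * A) : R := Q (mxvec_index x.1 x.2) 0.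

Lemma sa_vecK f x : sa_get (sa_vec f) x = f x.
Proof. by case: x => s a; rewrite /sa_get /sa_vec mxE mxvecE mxE. Qed.

Definition trans_mx (M : mdp) : 'M[R]_(N, nS.+1) :=
  \matrix_(i, s') sa_vec (fun x => trans M x.1 x.2 s') i 0.

Definition policy_mx (mu : S -> A -> R) : 'M[R]_(nS.+1, N) :=
  \matrix_(s, i) sa_vec (fun x => if x.1 == s then mu s x.2 else 0) i 0.

Definition mean_reward (M : mdp) : 'cV[R]_N :=
  sa_vec (fun x => \sum_s' trans M x.1 x.2 s' * reward M x.1 x.2 s').

Definition reward_max (M : mdp) : R :=
  \big[Num.max/0]_s \big[Num.max/0]_a \big[Num.max/0]_s' `|reward M s a s'|.

Definition value (Q : 'cV[R]_N) (s : S) : R :=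
  \big[Num.max/sa_get Q (s, ord0)]_a sa_get Q (s, a).

Definition bellman (M : mdp) (Q : 'cV[R]_N) : 'cV[R]_N :=
  mean_reward M + discount M *: (trans_mx M *m \col_s value Q s).

Definition behavior_kernel (M : mdp) (b : S -> A -> R) (x y : S * A) : R :=
  trans M x.1 x.2 y.1 * b y.1 y.2.

(* The iterate Q_k along the trajectory x 0, x 1, ... of state-action pairs. *)
Fixpoint q_iter (M : mdp) (alpha : R) (Q0 : 'cV[R]_N) (x : nat -> S * A)
    (k : nat) : 'cV[R]_N :=
  if k is j.+1 then
    let Q := q_iter M alpha Q0 x j in
    let s' := (x j.+1).1 in
    sa_vec (fun y =>
      if y == x j then
        sa_get Q y + alpha * (reward M y.1 y.2 s' + discount M * value Q s' - sa_get Q y)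
      else sa_get Q y)
  else Q0.

Definition d_min (d : S * A -> R) : R := \big[Num.min/d (ord0, ord0)]_x d x.
Definition d_max (d : S * A -> R) : R := \big[Num.max/d (ord0, ord0)]_x d x.

Definition switch_mx (M : mdp) (d : S * A -> R) (alpha : R) (pi : S -> A) : 'M[R]_N :=
  let D := diag_mx (sa_vec d)^T in
  1%:M - alpha *: D
    + (alpha * discount M) *: (D *m trans_mx M *m policy_mx (deterministic pi)).

Definition switch_family (M : mdp) (d : S * A -> R) (alpha : R) : set 'M[R]_N :=
  range (switch_mx M d alpha).

Definition W_max (M : mdp) (Q0 : 'cV[R]_N) : R :=
  (reward_max M
   + (1 + discount M) * Num.max `|Q0| (reward_max M / (1 - discount M))) ^+ 2.

End MDP.

(* Main.v *)
(** Along every trajectory the error e_k = Q_k - Q* satisfies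
    e_{k+1} = B_k e_k + alpha w_k with B_k in co(M_alpha), because V_{Q_k} - V_{Q*} is
    Pi^mu e_k for some stochastic policy mu.  Fix B in M_alpha and let u be the
    response of the time-invariant system u_{k+1} = B u_k + alpha w_k, u_0 = 0.
    Then e_k - B^k e_0 - u_k is driven through the B_k by (B_k - B)(B^k e_0 + u_k),
    where B_k - B has norm at most 2 alpha gamma d_max.  The part coming from B^k e_0 is
    controlled by K_beta, the part coming from u by the contraction factor
    1 - alpha d_min (1 - gamma) of every B_k.

    To bound E|u_k|, the Markovian noise is split with a truncated solution phi of the
    Poisson equation, |phi| <= 8 t_mix, into a martingale difference, a telescoping
    term, and a drift of order alpha.  The martingale part is bounded in L^2, the
    other two along each path. *)

Require Import Defs.
From HB Require Import structures.
From mathcomp Require Import all_boot all_order all_algebra.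
From mathcomp Require Import all_classical all_reals all_analysis.
From mathcomp Require Import measurable_realfun ring lra.

Set Implicit Arguments.
Unset Strict Implicit.
Unset Printing Implicit Defensive.

Import Order.TTheory GRing.Theory Num.Theory.
Import numFieldNormedType.Exports.

Local Open Scope classical_set_scope.
Local Open Scope ring_scope.

(** * Joint spectral radius *)

(** Working with one fixed matrix is forced by the noise. In the exact recursion the noise at time j
    is multiplied by B_{j+1}, ..., B_{k-1}, which depend on the observation that produced this noise
    and on later ones, so the conditional means of the products need not vanish and orthogonality is
    lost. Behind a deterministic matrix the martingale increments stay orthogonal: each has size of
    order alpha, the squares accumulate over about 1 / (alpha d_min (1 - gamma)) steps, and the root
    is of order sqrt(alpha / (d_min (1 - gamma))). The replacement costs a relative factor 2 alpha
    gamma d_max / (alpha d_min (1 - gamma)), in which alpha cancels. Q_k depends on finitely many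
    observations of a finite chain, so every expectation is a finite weighted sum over paths, and
    conditioning is a sum over the last state. *)

Section ColumnNorm.
Variables (R : realType) (n : nat).
Implicit Types (x y : 'cV[R]_n) (A B : 'M[R]_n).

Lemma col_norm_le x (c : R) : 0 <= c -> (forall i, `|x i 0| <= c) -> `|x| <= c.
Proof.
move=> c0 h; rewrite /Num.Def.normr /= mx_normrE bigmax_le// => -[i j] _ /=.
by rewrite ord1.
Qed.

Lemma col_norm_ge x i : `|x i 0| <= `|x|.
Proof.
rewrite [leRHS]/Num.Def.normr /= mx_normrE.
exact: (le_bigmax _ (fun ij => `|x ij.1 ij.2|) (i, 0)).
Qed.

(** A [sup] over an unbounded set has the default value 0, so every use of [norm_inf] rests on some
    such bound; a crude one is enough. *)
Lemma norm_mulmx_col_ub A : has_ubound [set `|A *m x| | x in [set x : 'cV[R]_n | `|x| <= 1]].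
Proof.
exists (\sum_i \sum_j `|A i j|) => _ [x /= x1 <-].
have s0 i : 0 <= \sum_j `|A i j| by apply: sumr_ge0.
apply: col_norm_le => [|i]; first exact: sumr_ge0.
apply: (@le_trans _ _ (\sum_j `|A i j|)); last first.
  by rewrite [leRHS](bigD1 i) //= lerDl sumr_ge0.
rewrite mxE (le_trans (ler_norm_sum _ _ _))// ler_sum// => j _.
by rewrite normrM ler_piMr// (le_trans (col_norm_ge _ _)).
Qed.

Lemma norm_inf_ge0 A : 0 <= norm_inf A.
Proof.
apply: (ub_le_sup (norm_mulmx_col_ub A)); exists 0; rewrite /= ?normr0//.
by rewrite mulmx0 normr0.
Qed.

Lemma norm_mulmx_le A x : `|A *m x| <= norm_inf A * `|x|.
Proof.
have [->|x0] := eqVneq x 0; first by rewrite mulmx0 !normr0 mulr0.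
have nx : 0 < `|x| by rewrite normr_gt0.
rewrite -ler_pdivrMr// mulrC -[X in X * _]ger0_norm ?invr_ge0// -normrZ scalemxAr.
apply: (ub_le_sup (norm_mulmx_col_ub A)); exists (`|x|^-1 *: x) => //=.
by rewrite normrZ ger0_norm ?invr_ge0// mulVf// gt_eqF.
Qed.

Lemma norm_inf_le A (c : R) : 0 <= c ->
  (forall x, `|A *m x| <= c * `|x|) -> norm_inf A <= c.
Proof.
move=> c0 h; apply: ge_sup.
  by exists 0, 0; rewrite /= ?mulmx0 normr0.
by move=> _ [x /= x1 <-]; rewrite (le_trans (h x))// ler_piMr.
Qed.

Lemma norm_inf1 : norm_inf (1%:M : 'M[R]_n) <= 1.
Proof. by apply: norm_inf_le => // x; rewrite mul1mx mul1r. Qed.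

Lemma norm_infM A B : norm_inf (A *m B) <= norm_inf A * norm_inf B.
Proof.
apply: norm_inf_le => [|x]; first by rewrite mulr_ge0 ?norm_inf_ge0.
rewrite -mulmxA (le_trans (norm_mulmx_le _ _))// -mulrA.
by rewrite ler_wpM2l ?norm_inf_ge0// norm_mulmx_le.
Qed.

Lemma norm_inf_sum (m : nat) (c : 'I_m -> R) (B : 'I_m -> 'M[R]_n) (k : R) :
  is_dist c -> 0 <= k -> (forall i, norm_inf (B i) <= k) ->
  norm_inf (\sum_i c i *: B i) <= k.
Proof.
move=> [c0 c1] k0 h; apply: norm_inf_le => // x.
rewrite mulmx_suml (le_trans (ler_norm_sum _ _ _))//.
rewrite -[leRHS]mul1r -c1 big_distrl ler_sum//= => i _.
rewrite -scalemxAl normrZ ger0_norm// ler_wpM2l// (le_trans (norm_mulmx_le _ _))//.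
by rewrite ler_wpM2r.
Qed.

End ColumnNorm.

(** * Growth rates of submultiplicative sequences *)

Section Submultiplicative.
Variables (R : realType) (a : nat -> R).
Hypotheses (a0 : forall n, 0 <= a n) (aM : forall m n, a (m + n) <= a m * a n).

Let root n := a n `^ (n%:R^-1).

Let root_ge0 n : 0 <= root n. Proof. exact: powR_ge0. Qed.

Let root_le n (x : R) : 0 <= x -> (0 < n)%N -> (root n <= x) = (a n <= x ^+ n).
Proof.
move=> x0 n0.
have nN : (n%:R : R) != 0 by rewrite pnatr_eq0 -lt0n.
have xE : x = (x ^+ n) `^ (n%:R^-1).
  by rewrite -powR_mulrn// -powRrM mulfV// powRr1.
apply/idP/idP => h.
  have -> : a n = root n ^+ n by rewrite -powR_mulrn// -powRrM mulVf// powRr1.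
  by rewrite lerXn2r ?nnegrE.
by rewrite xE /root ge0_ler_powR ?nnegrE ?exprn_ge0 ?invr_ge0.
Qed.

(** Euclidean division of [n] by [m]: every full block costs [s ^+ m], and the constant collects the
    finitely many possible remainders. The final [+ 1] in [C] makes it positive even when they all
    vanish. *)
Let geometric_bound m (s : R) : 0 < s -> (0 < m)%N -> a m <= s ^+ m ->
  exists2 C, 0 < C & forall n, a n <= C * s ^+ n.
Proof.
move=> s0 m0 ams; pose C := \sum_(i < m) a i / s ^+ i + 1.
have t0 (i : 'I_m) : 0 <= a i / s ^+ i by rewrite divr_ge0 ?exprn_ge0// ltW.
exists C; first by rewrite ltr_wpDl// sumr_ge0.
have aq q i : a (q * m + i) <= a m ^+ q * a i.
  elim: q => [|q IH]; first by rewrite expr0 mul1r.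
  by rewrite mulSn -addnA (le_trans (aM _ _))// exprS -mulrA ler_wpM2l.
move=> n; rewrite (divn_eq n m) (le_trans (aq _ _))// mulnC exprD exprM mulrCA.
apply: ler_pM; rewrite ?exprn_ge0//; first by rewrite lerXn2r ?nnegrE// exprn_ge0// ltW.
have im : (n %% m < m)%N by rewrite ltn_mod.
rewrite -ler_pdivrMr ?exprn_gt0// /C (bigD1 (Ordinal im)) //=.
by rewrite -addrA lerDl addr_ge0// sumr_ge0.
Qed.

(* Fekete's lemma: the limit is the infimum. *)
Lemma submultiplicative_root_cvg : cvgn root.
Proof.
(* At index 0 the root has exponent 0 and equals 1 whatever [a] is, so only positive indices
   count. *)
pose E := range (fun n => root n.+1).
have E0 : E !=set0 by exists (root 1); exists 0%N.
have lE : has_lbound E by exists 0 => _ [n _ <-].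
have r0 : 0 <= inf E by apply: lb_le_inf => // _ [n _ <-].
apply/cvg_ex; exists (inf E); apply/cvgrPdist_le => e e0.
have e20 : 0 < e / 2 by rewrite divr_gt0.
have [_ [m _ <-] hm] := inf_adherent e20 (conj E0 lE).
set s := inf E + e / 2 in hm.
have s0 : 0 < s by rewrite ltr_wpDl.
have ams : a m.+1 <= s ^+ m.+1 by rewrite -root_le// ltW.
have [C C0 hC] := geometric_bound s0 (ltn0Sn _) ams.
(* This choice gives [(1 + h) * s = inf E + e]. By Bernoulli's inequality the powers of [1 + h]
   eventually absorb the constant [C]. *)
pose h := e / 2 / s; have h0 : 0 < h by rewrite divr_gt0.
near=> n.
have n0 : (0 < n)%N by near: n; exact: nbhs_infty_gt.
have hn : C <= 1 + n%:R * h.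
  rewrite -lerBlDl -ler_pdivrMr//; near: n; exact: nbhs_infty_ger.
have hl : inf E <= root n by apply: ge_inf => //; exists n.-1; rewrite // prednK.
have hr : root n <= inf E + e.
  rewrite root_le ?addr_ge0 ?(ltW e0)// (le_trans (hC n))//.
  have -> : inf E + e = (1 + h) * s.
    by rewrite mulrDl mul1r divfK ?gt_eqF// /s -addrA -splitr.
  rewrite exprMn ler_wpM2r ?exprn_ge0 ?(ltW s0)// (le_trans hn)//.
  elim: (n) => [|j IH]; first by rewrite mul0r addr0 expr0.
  rewrite exprS -natr1; apply: le_trans (ler_wpM2l _ IH); last lra.
  have : 0 <= j%:R * (h * h) by rewrite mulr_ge0// mulr_ge0 ?ltW.
  lra.
by rewrite ler_norml; apply/andP; split; lra.
Unshelve. all: end_near. Qed.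

Lemma submultiplicative_root_lim_ge0 : 0 <= limn root.
Proof.
apply: limr_ge => //; first exact: submultiplicative_root_cvg.
exact: nearW.
Qed.

Lemma submultiplicative_growth (beta : R) : limn root < beta ->
  exists C, forall n, a n <= C * beta ^+ n.
Proof.
move=> hb; have b0 : 0 < beta by apply: le_lt_trans hb; exact: submultiplicative_root_lim_ge0.
have /cvgrPdist_lt h := submultiplicative_root_cvg.
have [|N _ hN] := h (beta - limn root); first by rewrite subr_gt0.
have aN : a N.+1 <= beta ^+ N.+1.
  rewrite -root_le// ?ltW//; have := hN N.+1 (leqnSn N).
  rewrite distrC => /(le_lt_trans (ler_norm _)); lra.
by have [C _ hC] := geometric_bound b0 (ltn0Sn _) aN; exists C.
Qed.

End Submultiplicative.

(** * Products of matrices from a bounded family and from its convex hull *)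

Section Growth.
Variables (R : realType) (n : nat) (H : set 'M[R]_n) (L : R).
Hypotheses (H0 : H !=set0) (HL : forall A, H A -> norm_inf A <= L).

Lemma left_prod_add (B : nat -> 'M[R]_n) i j :
  left_prod B (i + j) = left_prod (fun l => B (l + j)%N) i *m left_prod B j.
Proof. by elim: i => [|i IH] /=; rewrite ?mul1mx// IH mulmxA. Qed.

Lemma eq_left_prod (B C : nat -> 'M[R]_n) k :
  (forall i, (i < k)%N -> B i = C i) -> left_prod B k = left_prod C k.
Proof.
elim: k => //= k IH h; rewrite h// IH// => i ik; apply: h.
exact: ltn_trans ik _.
Qed.

Let prods k := [set norm_inf (left_prod B k) | B in [set B | forall i, H (B i)]].

Let prods0 k : prods k !=set0.
Proof. by have [A HA] := H0; exists (norm_inf (left_prod (fun=> A) k)); exists (fun=> A). Qed.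

Let prods_ub k : has_ubound (prods k).
Proof.
exists (L ^+ k) => _ [B /= hB <-]; elim: k => [|k IH] /=; first exact: norm_inf1.
by rewrite (le_trans (norm_infM _ _))// exprS ler_pM ?norm_inf_ge0// HL.
Qed.

Lemma left_prod_le_max B k : (forall i, H (B i)) ->
  norm_inf (left_prod B k) <= max_prod_norm H k.
Proof. by move=> hB; apply: ub_le_sup; [exact: prods_ub|exists B]. Qed.

Lemma max_prod_norm_ge0 k : 0 <= max_prod_norm H k.
Proof.
have [A HA] := H0.
by apply: le_trans (left_prod_le_max k (fun=> HA)); exact: norm_inf_ge0.
Qed.

Lemma max_prod_normM j k :
  max_prod_norm H (j + k) <= max_prod_norm H j * max_prod_norm H k.
Proof.
apply: ge_sup; first exact: prods0.
move=> _ [B /= hB <-]; rewrite left_prod_add (le_trans (norm_infM _ _))//.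
by rewrite ler_pM ?norm_inf_ge0// left_prod_le_max.
Qed.

(** The definition takes the root inside the supremum. Monotonicity of roots and powers moves it
    outside, where the submultiplicativity of [max_prod_norm] can be used. *)
Lemma joint_spectral_radiusE :
  joint_spectral_radius H = limn (fun k => max_prod_norm H k `^ (k%:R^-1)).
Proof.
congr (limn _); apply/funext => k; apply/eqP; rewrite eq_le.
set E := [set norm_inf _ `^ _ | _ in _].
have Eub y : E y -> y <= max_prod_norm H k `^ k%:R^-1.
  move=> [B hB <-]; rewrite ge0_ler_powR ?nnegrE ?norm_inf_ge0 ?max_prod_norm_ge0//.
  by rewrite left_prod_le_max.
have E0 : E !=set0.
  have [A HA] := H0.
  by exists (norm_inf (left_prod (fun=> A) k) `^ k%:R^-1); exists (fun=> A).
apply/andP; split; first exact: ge_sup.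
have Ele B : (forall i, H (B i)) -> norm_inf (left_prod B k) `^ k%:R^-1 <= sup E.
  by move=> hB; apply: ub_le_sup; [exists (max_prod_norm H k `^ k%:R^-1)|exists B].
(* For [k = 0] the exponent is 0 and both sides are 1; inverting the root needs [k] positive. *)
have [k0|k0] := posnP k.
  have [A HA] := H0; apply: le_trans (Ele (fun=> A) (fun=> HA)).
  by rewrite k0 invr0 !powRr0.
have kN : (k%:R : R) != 0 by rewrite pnatr_eq0 -lt0n.
have s0 : 0 <= sup E.
  by have [A HA] := H0; apply: le_trans (Ele (fun=> A) (fun=> HA)); exact: powR_ge0.
have -> : sup E = (sup E `^ k%:R) `^ k%:R^-1 by rewrite -powRrM mulfV// powRr1.
rewrite ge0_ler_powR ?nnegrE ?powR_ge0 ?max_prod_norm_ge0//.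
apply: ge_sup; first exact: prods0.
move=> _ [B hB <-]; set x := norm_inf _.
have -> : x = (x `^ k%:R^-1) `^ k%:R.
  by rewrite -powRrM mulVf// powRr1// norm_inf_ge0.
by rewrite ge0_ler_powR ?nnegrE ?powR_ge0 ?Ele.
Qed.

Lemma joint_spectral_radius_ge0 : 0 <= joint_spectral_radius H.
Proof.
rewrite joint_spectral_radiusE; apply: submultiplicative_root_lim_ge0.
  exact: max_prod_norm_ge0.
exact: max_prod_normM.
Qed.

(* A product is affine in each factor, so its norm is maximal at the vertices. *)
Lemma hull_prod_le_max B k : (forall i, convex_hull H (B i)) ->
  norm_inf (left_prod B k) <= max_prod_norm H k.
Proof.
move=> hB.
(* The left factor [C] makes the induction pass: it absorbs the leftmost hull factor, which is
   expanded over vertices only after the shorter product on its right has been reduced to factors in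
   [H]. *)
suff gen (c : R) : 0 <= c -> forall C : 'M[R]_n,
    (forall A, (forall i, H (A i)) -> norm_inf (C *m left_prod A k) <= c) ->
    norm_inf (C *m left_prod B k) <= c.
  rewrite -[left_prod B k]mul1mx; apply: gen; first exact: max_prod_norm_ge0.
  by move=> A hA; rewrite mul1mx left_prod_le_max.
move=> c0; elim: k => [|k IH] C hC /=.
  by have [A HA] := H0; exact: (hC (fun=> A)).
rewrite mulmxA; apply: IH => A hA.
have [m [w [V [hw hV ->]]]] := hB k.
rewrite mulmx_sumr mulmx_suml.
under eq_bigr do rewrite -scalemxAr -scalemxAl.
apply: norm_inf_sum => // i.
pose A' j := if j == k then V i else A j.
have -> : C *m V i *m left_prod A k = C *m left_prod A' k.+1.
  rewrite /= /A' eqxx mulmxA; congr (_ *m _); apply: eq_left_prod => j jk.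
  by rewrite ltn_eqF.
by apply: hC => j; rewrite /A'; case: eqP.
Qed.

(* [growth_const] is a [sup], which would be 0 on an unbounded set: boundedness comes
   from the convergence of the roots in the definition of the joint spectral radius. *)
Lemma hull_prod_le_growth (beta : R) B k : joint_spectral_radius H < beta ->
  (forall i, convex_hull H (B i)) ->
  norm_inf (left_prod B k) <= growth_const H beta * beta ^+ k.
Proof.
move=> hb hB; have b0 : 0 < beta by apply: le_lt_trans hb; exact: joint_spectral_radius_ge0.
have := hb; rewrite joint_spectral_radiusE => hb'.
have [C hC] := submultiplicative_growth max_prod_norm_ge0 max_prod_normM hb'.
have hull_le B' l : (forall i, convex_hull H (B' i)) ->
    norm_inf (left_prod B' l) <= max_prod_norm (convex_hull H) l.
  move=> hB'; apply: ub_le_sup; last by exists B'.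
  by exists (max_prod_norm H l) => _ [B'' hB'' <-]; exact: hull_prod_le_max.
apply: le_trans (hull_le _ _ hB) _.
rewrite -ler_pdivrMr ?exprn_gt0// mulrC; apply: ub_le_sup; last by exists k.
exists C => _ [l _ <-]; rewrite mulrC ler_pdivrMr ?exprn_gt0// (le_trans _ (hC l))//.
apply: ge_sup; first by exists (norm_inf (left_prod B l)); exists B.
by move=> _ [B' hB' <-]; exact: hull_prod_le_max.
Qed.

End Growth.

(** * Expectations over finite paths *)

Section PathExpectation.
Variables (R : realType) (T : finType) (d : T -> R) (K : T -> T -> R).
Hypotheses (d_dist : is_dist d) (K_dist : forall x, is_dist (K x)).
Implicit Types (p q : nat -> T) (f g : (nat -> T) -> R).

(** Finite paths are coded as total functions, constant after their end, so that one type serves all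
    lengths and also the trajectories [X^~ w]. *)
Definition extend p k y : nat -> T := fun i => if (i <= k)%N then p i else y.

Fixpoint paths k : seq (nat -> T) :=
  if k is k'.+1 then [seq extend p k' y | p <- paths k', y <- enum T]
  else [seq (fun=> x) | x <- enum T].

Definition path_weight p k : R := d (p 0%N) * \prod_(i < k) K (p i) (p i.+1).

Definition path_expect k f : R := \sum_(p <- paths k) path_weight p k * f p.

(** Measurability with respect to the natural filtration of a discrete process, expressed as
    dependence on the coordinates 0 to [k] only. *)
Definition adapted (V : Type) k (f : (nat -> T) -> V) : Prop :=
  forall p q, (forall i, (i <= k)%N -> p i = q i) -> f p = f q.

Lemma extend_le p k y i : (i <= k)%N -> extend p k y i = p i.
Proof. by rewrite /extend => ->. Qed.

Lemma extend_last p k y : extend p k y k.+1 = y.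
Proof. by rewrite /extend ltnn. Qed.

Lemma adapted_extend (V : Type) k (f : (nat -> T) -> V) p y :
  adapted k f -> f (extend p k y) = f p.
Proof. by move=> fk; apply: fk => i ik; exact: extend_le. Qed.

Lemma adapted_widen (V : Type) j k (f : (nat -> T) -> V) :
  (j <= k)%N -> adapted j f -> adapted k f.
Proof. by move=> jk fj p q pq; apply: fj => i ij; apply: pq; exact: leq_trans jk. Qed.

Lemma path_weight_extend p k y :
  path_weight (extend p k y) k.+1 = path_weight p k * K (p k) y.
Proof.
rewrite /path_weight big_ord_recr /= mulrA extend_last !extend_le//.
congr (_ * _ * _); apply: eq_bigr => i _.
by rewrite !extend_le// ltnW.
Qed.

Lemma path_expect0 f : path_expect 0 f = \sum_x d x * f (fun=> x).
Proof.
rewrite /path_expect /= big_map big_enum; apply: eq_bigr => x _.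
by rewrite /path_weight big_ord0 mulr1.
Qed.

Lemma path_expectS k f : path_expect k.+1 f =
  path_expect k (fun p => \sum_y K (p k) y * f (extend p k y)).
Proof.
rewrite /path_expect /= big_allpairs_dep /=; apply: eq_bigr => p _.
rewrite big_distrr big_enum /=; apply: eq_bigr => y _.
by rewrite path_weight_extend mulrA.
Qed.

Lemma path_weight_ge0 p k : 0 <= path_weight p k.
Proof.
rewrite mulr_ge0 ?prodr_ge0//; first by case: d_dist.
by move=> i _; case: (K_dist (p i)).
Qed.

Lemma path_expect_le k f g : (forall p, f p <= g p) -> path_expect k f <= path_expect k g.
Proof. by move=> fg; apply: ler_sum => p _; rewrite ler_wpM2l ?path_weight_ge0. Qed.

Lemma eq_path_expect k f g : f =1 g -> path_expect k f = path_expect k g.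
Proof. by move=> fg; apply: eq_bigr => p _; rewrite fg. Qed.

Lemma path_expectD k f g :
  path_expect k (fun p => f p + g p) = path_expect k f + path_expect k g.
Proof. by rewrite -big_split; apply: eq_bigr => p _; rewrite mulrDr. Qed.

Lemma path_expectZ k c f : path_expect k (fun p => c * f p) = c * path_expect k f.
Proof. by rewrite [RHS]big_distrr; apply: eq_bigr => p _; rewrite mulrCA. Qed.

Lemma path_expect_cst k c : path_expect k (fun=> c) = c.
Proof.
elim: k => [|k IH].
  by rewrite path_expect0 -big_distrl /=; case: d_dist => _ ->; rewrite mul1r.
rewrite path_expectS -[RHS]IH; apply: eq_path_expect => p.
by rewrite -big_distrl /=; case: (K_dist (p k)) => _ ->; rewrite mul1r.
Qed.

Lemma path_expect_sum k (I : finType) (F : I -> (nat -> T) -> R) :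
  path_expect k (fun p => \sum_i F i p) = \sum_i path_expect k (F i).
Proof.
by rewrite exchange_big; apply: eq_bigr => p _; rewrite big_distrr.
Qed.

Lemma path_expect_adapted j k f : (j <= k)%N -> adapted j f ->
  path_expect k f = path_expect j f.
Proof.
move=> jk fj; elim: k jk => [|k IH]; first by rewrite leqn0 => /eqP ->.
rewrite leq_eqVlt => /predU1P[-> //|/ltnSE jk]; rewrite -(IH jk) path_expectS.
apply: eq_path_expect => p.
under eq_bigr do rewrite (adapted_extend _ _ (adapted_widen jk fj)).
by rewrite -big_distrl /=; case: (K_dist (p k)) => _ ->; rewrite mul1r.
Qed.

(** Orthogonality of a martingale increment: once the path up to [k] is fixed, [f] is a constant and
    the cross term averages to 0. *)
Lemma path_expect_martingale k f g : adapted k f ->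
    (forall p, \sum_y K (p k) y * g (extend p k y) = 0) ->
  path_expect k.+1 (fun p => (f p + g p) ^+ 2) =
  path_expect k (fun p => f p ^+ 2) + path_expect k.+1 (fun p => g p ^+ 2).
Proof.
move=> fk g0; rewrite !path_expectS -path_expectD; apply: eq_path_expect => p.
rewrite (eq_bigr (fun y => f p ^+ 2 * K (p k) y +
    2 * f p * (K (p k) y * g (extend p k y)) + K (p k) y * g (extend p k y) ^+ 2)).
  rewrite !big_split /= -!big_distrr /= g0 mulr0 addr0.
  by case: (K_dist (p k)) => _ ->; rewrite mulr1.
by move=> y _; rewrite (adapted_extend _ _ fk); ring.
Qed.

(** The variance of [|f|] is nonnegative. *)
Lemma path_expect_norm k f c : 0 <= c -> path_expect k (fun p => f p ^+ 2) <= c ->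
  path_expect k (fun p => `|f p|) <= Num.sqrt c.
Proof.
move=> c0 fc; set e := path_expect _ _.
have e0 : 0 <= e by rewrite -(path_expect_cst k 0) path_expect_le.
rewrite -[leLHS](@ger0_norm _ e)// -sqrtr_sqr ler_sqrt//.
apply: le_trans fc; rewrite -subr_ge0.
have -> : path_expect k (fun p => f p ^+ 2) - e ^+ 2 =
    path_expect k (fun p => (`|f p| - e) ^+ 2).
  have -> : path_expect k (fun p => (`|f p| - e) ^+ 2) =
      path_expect k (fun p => f p ^+ 2 + (- 2 * e) * `|f p| + e ^+ 2).
    by apply: eq_path_expect => p; rewrite -(real_normK (num_real (f p))); ring.
  by rewrite !path_expectD path_expectZ path_expect_cst -/e; ring.
by rewrite -(path_expect_cst k 0) path_expect_le// => p; exact: sqr_ge0.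
Qed.

End PathExpectation.

(** * From the probability space to finite paths *)

Section ChainExpectation.
Variables (R : realType) (T : finType) (d : T -> R) (K : T -> T -> R).
Variables (dO : measure_display) (Omega : measurableType dO).
Variables (Pr : probability Omega R) (X : nat -> Omega -> T).
Hypothesis X_chain : markov_chain Pr X d K.

Lemma path_event0 x : path_event X x 0 = [set w | X 0%N w = x 0%N].
Proof.
apply/seteqP; split => w /= h; first exact: h.
by move=> i; rewrite leqn0 => /eqP ->.
Qed.

Lemma path_eventS x k :
  path_event X x k.+1 = path_event X x k `&` [set w | X k.+1 w = x k.+1].
Proof.
apply/seteqP; split => w /=.
  by move=> h; split; [move=> i ik; apply: h; exact: leqW|exact: h].
by move=> [h hk] i; rewrite leq_eqVlt => /predU1P[->//|]; exact: h.
Qed.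

Lemma measurable_path_event x k : measurable (path_event X x k).
Proof.
elim: k => [|k IH]; first by rewrite path_event0; exact: (markov_measurable X_chain).
by rewrite path_eventS; apply: measurableI => //; exact: (markov_measurable X_chain).
Qed.

Lemma path_event_prob x k : Pr (path_event X x k) = (path_weight d K x k)%:E.
Proof.
elim: k => [|k IH].
  by rewrite path_event0 (markov_init X_chain) /path_weight big_ord0 mulr1.
by rewrite (markov_step X_chain) IH -EFinM /path_weight big_ord_recr mulrA.
Qed.

(** The trajectory lies in exactly one path event of each length, so an adapted function is a simple
    function. *)
Lemma adapted_indic_sum k (f : (nat -> T) -> R) w : adapted k f ->
  f (X^~ w) = \sum_(p <- paths T k) f p * \1_(path_event X p k) w.
Proof.
elim: k f => [|k IH] f fk.
  rewrite big_map big_enum /= (bigD1 (X 0%N w)) //= big1 ?addr0.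
    rewrite path_event0 indicE mem_set//= mulr1; apply: fk => i.
    by rewrite leqn0 => /eqP ->.
  by move=> x xX; rewrite path_event0 indicE memNset ?mulr0//= => /esym/eqP; exact/negP.
rewrite /= big_allpairs_dep /=.
(* Freezing the last observation turns [f] into a function adapted to [k], to which the induction
   hypothesis applies. *)
pose g p := f (extend p k (X k.+1 w)).
have -> : f (X^~ w) = g (X^~ w).
  apply: fk => i; rewrite leq_eqVlt => /predU1P[->|ik]; first by rewrite extend_last.
  by rewrite extend_le.
rewrite IH; last first.
  move=> p q pq; apply: fk => i; rewrite leq_eqVlt => /predU1P[->|ik].
    by rewrite !extend_last.
  by rewrite !extend_le// pq.
apply: eq_bigr => p _; rewrite big_enum /= (bigD1 (X k.+1 w)) //= big1 ?addr0.
  congr (_ * _); rewrite path_eventS indicI /= [X in _ = _ * X]indicE mem_set /= ?extend_last//.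
  rewrite mulr1 !indicE; congr ((_ : bool)%:R); apply/idP/idP; rewrite !inE => h i ik;
  by rewrite h// extend_le.
move=> y yX; rewrite path_eventS indicI /= [X in _ * (_ * X)]indicE memNset ?mulr0//=.
by rewrite extend_last => /esym/eqP; exact/negP.
Qed.

(** The bridge from the integral to finite sums. Nonnegativity permits termwise integration without
    integrability conditions. *)
Lemma chain_expectation k (f : (nat -> T) -> R) : (forall p, 0 <= f p) -> adapted k f ->
  ('E_Pr[fun w => f (X^~ w)] = (path_expect d K k f)%:E)%E.
Proof.
move=> f0 fk; rewrite unlock.
pose g p w : \bar R := ((f p)%:E * (\1_(path_event X p k) w)%:E)%E.
have mg p : measurable_fun setT (fun w => (\1_(path_event X p k) w : R)%:E).
  by apply/measurable_EFinP; apply: measurable_indic; exact: measurable_path_event.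
transitivity (\int[Pr]_w (\sum_(p <- paths T k) g p w))%E.
  apply: eq_integral => w _; rewrite (adapted_indic_sum _ fk) -sumEFin.
  by apply: eq_bigr => p _; rewrite EFinM.
rewrite ge0_integral_sum; last 3 first.
- exact: measurableT.
- by move=> p; apply: emeasurable_funM; [exact: measurable_cst|exact: mg].
- by move=> p w _; rewrite /g -EFinM lee_fin mulr_ge0.
rewrite /path_expect -sumEFin; apply: eq_bigr => p _.
rewrite /g ge0_integralZl_EFin; last 4 first.
- exact: measurableT.
- by move=> w _; rewrite lee_fin.
- exact: mg.
- exact: f0.
rewrite integral_indic; last 2 first.
- exact: measurableT.
- exact: measurable_path_event.
by rewrite setIT EFinM muleC; congr (_ * _)%E; exact: path_event_prob.
Qed.

End ChainExpectation.

(** * Driven linear systems and the Poisson equation *)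

Section Response.
Variables (R : realType) (n : nat).
Implicit Types (B : nat -> 'M[R]_n) (g : nat -> 'cV[R]_n) (x : 'cV[R]_n).

(** The input [g j] enters at time j+1 and then passes through k-1-j matrices; hence the exponents
    [k.-1 - j] below. For [k = 0] those sums are empty, so the value of [k.-1] is harmless. *)
Fixpoint response B g (k : nat) : 'cV[R]_n :=
  if k is j.+1 then B j *m response B g j + g j else 0.

Lemma responseD B g h k :
  response B (fun j => g j + h j) k = response B g k + response B h k.
Proof. by elim: k => [|k IH] /=; rewrite ?addr0// IH mulmxDr addrACA. Qed.

Lemma geometric_sum_le (r : R) k : 0 <= r < 1 ->
  \sum_(j < k) r ^+ (k.-1 - j) <= (1 - r)^-1.
Proof.
move=> /andP[r0 r1]; have r1' : 0 < 1 - r by rewrite subr_gt0.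
have -> : \sum_(j < k) r ^+ (k.-1 - j) = \sum_(j < k) r ^+ j.
  rewrite (reindex_inj rev_ord_inj) /=; apply: eq_bigr => j _.
  by congr (_ ^+ _); case: k j => [[]|k] //= j; rewrite subSS subKn// -ltnS.
rewrite -[leRHS]mul1r ler_pdivlMr// mulrC.
have -> : (1 - r) * \sum_(j < k) r ^+ j = 1 - r ^+ k.
  by rewrite -opprB mulNr -subrX1 opprB.
by rewrite gerBl exprn_ge0.
Qed.

Lemma response_norm B g k (r : R) : 0 <= r ->
    (forall i x, `|B i *m x| <= r * `|x|) ->
  `|response B g k| <= \sum_(j < k) r ^+ (k.-1 - j) * `|g j|.
Proof.
move=> r0 hB; elim: k => [|k IH] /=; first by rewrite big_ord0 normr0.
rewrite big_ord_recr /= subnn expr0 mul1r (le_trans (ler_normD _ _))// lerD2r.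
rewrite (le_trans (hB _ _))// (le_trans (ler_wpM2l r0 IH))// big_distrr /=.
rewrite le_eqVlt; apply/orP; left; apply/eqP/eq_bigr => j _.
rewrite mulrA -exprS; congr (_ ^+ _ * _); case: k j {IH} => [[]|k] //= j.
by rewrite subSn// -ltnS.
Qed.

Lemma response_le B g k (r G : R) : 0 <= r < 1 -> 0 <= G ->
    (forall i x, `|B i *m x| <= r * `|x|) -> (forall j, `|g j| <= G) ->
  `|response B g k| <= G / (1 - r).
Proof.
move=> r01 G0 hB hg; have /andP[r0 r1] := r01.
apply: le_trans (response_norm _ _ r0 hB) _.
apply: (@le_trans _ _ (G * \sum_(j < k) r ^+ (k.-1 - j))).
  by rewrite big_distrr ler_sum// => j _ /=; rewrite mulrC ler_wpM2r ?exprn_ge0.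
by rewrite ler_wpM2l ?geometric_sum_le.
Qed.

Lemma responseE B g k : response B g k =
  \sum_(j < k) left_prod (fun i => B (i + j.+1)%N) (k.-1 - j) *m g j.
Proof.
elim: k => [|k IH] /=; first by rewrite big_ord0.
rewrite IH big_ord_recr /= subnn mul1mx; congr (_ + _); rewrite mulmx_sumr.
apply: eq_bigr => -[j jk] _ /=; rewrite mulmxA; congr (_ *m _).
case: k jk {IH} => // k /ltnSE jk; rewrite (subSn jk) /= addnS subnK//.
Qed.

(** In each of the [k] terms of [responseE] the exponents k-1-j of the product and j of the input
    add up to k-1, whence the factor [k%:R * beta ^+ k.-1]. *)
Lemma response_growth B g k (K G beta : R) : 0 <= K -> 0 <= beta ->
    (forall i l, norm_inf (left_prod (fun j => B (j + i)%N) l) <= K * beta ^+ l) ->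
    (forall j, `|g j| <= G * beta ^+ j) ->
  `|response B g k| <= K * G * (k%:R * beta ^+ k.-1).
Proof.
move=> K0 b0 hB hg; rewrite responseE (le_trans (ler_norm_sum _ _ _))//.
have -> : K * G * (k%:R * beta ^+ k.-1) = \sum_(j < k) K * G * beta ^+ k.-1.
  by rewrite sumr_const card_ord -[RHS]mulr_natl mulrCA.
apply: ler_sum => -[j jk] _ /=; rewrite (le_trans (norm_mulmx_le _ _))//.
have -> : K * G * beta ^+ k.-1 = K * beta ^+ (k.-1 - j) * (G * beta ^+ j).
  rewrite mulrACA -exprD subnK//; by case: k jk.
by rewrite ler_pM// norm_inf_ge0.
Qed.

Lemma response_perturb B (M : 'M[R]_n) (e w : nat -> 'cV[R]_n) k :
    (forall j, e j.+1 = B j *m e j + w j) ->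
  let u := response (fun=> M) w in
  let v j := left_prod (fun=> M) j *m e 0%N in
  e k = v k + u k + response B (fun j => (B j - M) *m v j) k
        + response B (fun j => (B j - M) *m u j) k.
Proof.
move=> he u v; elim: k => [|k IH] /=.
  by rewrite /v /u /= mul1mx !addr0.
have -> : v k.+1 = M *m v k by rewrite /v /= mulmxA.
have -> : u k.+1 = M *m u k + w k by [].
rewrite he IH !mulmxDr !mulmxBl.
move: (B k *m v k) (B k *m u k) (M *m v k) (M *m u k) (w k).
move: (B k *m response _ _ _) (B k *m response _ _ _) => z1 z2 a b a' b' c.
by apply/colP => i; rewrite !mxE; ring.
Qed.

End Response.

(** * Second moments of linear systems driven by martingale differences *)

Section MartingaleResponse.
Variables (R : realType) (T : finType) (d : T -> R) (K : T -> T -> R) (n : nat).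
Variables (M : 'M[R]_n) (m : nat -> (nat -> T) -> 'cV[R]_n) (r C : R).
Hypotheses (d_dist : is_dist d) (K_dist : forall x, is_dist (K x)).
Hypotheses (r01 : 0 <= r < 1) (M_le : forall x : 'cV[R]_n, `|M *m x| <= r * `|x|).
Hypotheses (m_adapted : forall k, adapted k.+1 (m k)).
Hypotheses (m_mean0 : forall k p, \sum_y K (p k) y *: m k (extend p k y) = 0).
Hypotheses (m_le : forall k p, `|m k p| <= C).

Let resp k p := response (fun=> M) (m^~ p) k.

Lemma adapted_response k : adapted k (resp k).
Proof.
move=> p q; rewrite /resp; elim: k => //= k IH pq.
by rewrite IH ?(m_adapted pq)// => i ik; rewrite pq// ltnW.
Qed.

(** Induction over all row functionals at once: peeling off the last step replaces [c] by [c *m M],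
    whose dual norm is smaller by the factor [r]. With G = C^2 / (1 - r), orthogonality reduces the
    step to r^2 G + C^2 <= G, which holds because r^2 <= r. *)
Lemma martingale_response_sqr k (c : 'rV[R]_n) (kap : R) : 0 <= kap ->
    (forall x : 'cV[R]_n, `|(c *m x) 0 0| <= kap * `|x|) ->
  path_expect d K k (fun p => (c *m resp k p) 0 0 ^+ 2)
    <= kap ^+ 2 * (C ^+ 2 / (1 - r)).
Proof.
have /andP[r0 r1] := r01; have r1' : 0 < 1 - r by rewrite subr_gt0.
have G0 : 0 <= C ^+ 2 / (1 - r) := divr_ge0 (sqr_ge0 C) (ltW r1').
elim: k c kap => [|k IH] c kap kap0 hc.
  rewrite (eq_path_expect _ _ _ (g := fun=> 0)).
    by rewrite path_expect_cst// mulr_ge0// sqr_ge0.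
  by move=> p; rewrite /resp /= mulmx0 mxE expr0n.
rewrite (eq_path_expect _ _ _ (g := fun p => (((c *m M) *m resp k p) 0 0
    + (c *m m k p) 0 0) ^+ 2)); last first.
  by move=> p; rewrite /resp /= mulmxDr mulmxA mxE.
rewrite (path_expect_martingale d K_dist (k := k)); last 2 first.
- by move=> p q /adapted_response ->.
- move=> p.
  rewrite (_ : \sum_y _ = (c *m \sum_y K (p k) y *: m k (extend p k y)) 0 0).
    by rewrite m_mean0 mulmx0 mxE.
  by rewrite mulmx_sumr summxE; apply: eq_bigr => y _; rewrite -scalemxAr [RHS]mxE.
have h1 : path_expect d K k (fun p => ((c *m M) *m resp k p) 0 0 ^+ 2)
    <= (kap * r) ^+ 2 * (C ^+ 2 / (1 - r)).
  apply: IH => [|x]; first by rewrite mulr_ge0.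
  by rewrite -mulmxA (le_trans (hc _))// -mulrA ler_wpM2l.
have h2 : path_expect d K k.+1 (fun p => (c *m m k p) 0 0 ^+ 2) <= kap ^+ 2 * C ^+ 2.
  rewrite -(path_expect_cst d_dist K_dist k.+1 (kap ^+ 2 * C ^+ 2)).
  apply: path_expect_le => // p; rewrite -exprMn -[leLHS]real_normK ?num_real//.
  have mC := m_le k p; have C0' : 0 <= C := le_trans (normr_ge0 _) mC.
  rewrite lerXn2r ?nnegrE ?mulr_ge0//.
  by rewrite (le_trans (hc _))// ler_wpM2l.
apply: le_trans (lerD h1 h2) _.
have -> : kap ^+ 2 * C ^+ 2 = kap ^+ 2 * (C ^+ 2 / (1 - r)) * (1 - r).
  by field; rewrite gt_eqF.
have : 0 <= kap ^+ 2 * (C ^+ 2 / (1 - r)).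
  by rewrite mulr_ge0// sqr_ge0.
set A := _ * (_ / _) => A0.
have -> : (kap * r) ^+ 2 * (C ^+ 2 / (1 - r)) = A * r ^+ 2 by rewrite /A exprMn mulrAC.
have : 0 <= A * (r - r ^+ 2).
  by rewrite mulr_ge0// subr_ge0 expr2 ler_piMr// ltW.
lra.
Qed.

(** Orthogonality is available for scalar functionals only, so the maximum norm is bounded by the
    sum of the coordinates. This is where the dimension enters. *)
Lemma martingale_response_norm k :
  path_expect d K k (fun p => `|resp k p|) <= n%:R * Num.sqrt (C ^+ 2 / (1 - r)).
Proof.
have /andP[r0 r1] := r01; have r1' : 0 < 1 - r by rewrite subr_gt0.
apply: (@le_trans _ _ (path_expect d K k (fun p => \sum_i `|resp k p i 0|))).
  apply: path_expect_le => // p; apply: col_norm_le => [|i]; first exact: sumr_ge0.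
  by rewrite (bigD1 i) //= lerDl sumr_ge0.
rewrite path_expect_sum -[n in leRHS]card_ord mulr_natl -sumr_const.
apply: ler_sum => i _.
have dE (x : 'cV[R]_n) : x i 0 = ((delta_mx 0 i : 'rV[R]_n) *m x) 0 0.
  by rewrite -rowE mxE.
apply: path_expect_norm => //; first exact: divr_ge0 (sqr_ge0 C) (ltW r1').
rewrite (eq_path_expect _ _ _ (g := fun p => ((delta_mx 0 i : 'rV[R]_n) *m resp k p) 0 0 ^+ 2)).
  rewrite -[leRHS]mul1r -[X in X * _](expr1n _ 2); apply: martingale_response_sqr => // x.
  by rewrite -dE mul1r col_norm_ge.
by move=> p; rewrite dE.
Qed.

End MartingaleResponse.

(** * The truncated Poisson equation under geometric mixing *)

Section TruncatedPoisson.
Variables (R : realType) (T : finType) (d : T -> R) (K : T -> T -> R).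
Hypothesis K_dist : forall x, is_dist (K x).

(** A partial sum of the series for the deviation matrix of the chain. Stopping at [L] avoids any
    convergence argument or inverse of I - K. *)
Definition poisson_sol L (y x : T) : R := \sum_(l < L) (kernel_iter K l x y - d y).

(** Telescoping: the constants [d y] cancel because [K] preserves constants. The right side differs
    from that of the exact Poisson equation by [kernel_iter K L x y - d y]. *)
Lemma poisson_solE L y x :
  poisson_sol L y x - \sum_z K x z * poisson_sol L y z
  = (x == y)%:R - kernel_iter K L x y.
Proof.
elim: L => [|L IH].
  rewrite /poisson_sol big_ord0 big1 ?subrr// => z _.
  by rewrite big_ord0 mulr0.
have -> : \sum_z K x z * poisson_sol L.+1 y z =
    \sum_z K x z * poisson_sol L y z + (kernel_iter K L.+1 x y - d y).
  have -> : d y = \sum_z K x z * d y.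
    by rewrite -big_distrl /=; case: (K_dist x) => _ ->; rewrite mul1r.
  rewrite /= -sumrB -big_split; apply: eq_bigr => z _ /=.
  by rewrite /poisson_sol big_ord_recr /= mulrDr mulrBr.
rewrite /poisson_sol big_ord_recr /= -/(poisson_sol L y x).
by move: IH => /=; set a := \sum_z K x z * poisson_sol L y z => IH; lra.
Qed.

Variable t : R.
Hypothesis t1 : 1 <= t.
Hypothesis t_mix : forall l : nat,
  \big[Num.max/0]_x tv_dist (kernel_iter K l x) d <= 2 ^ (- Num.floor (l%:R / t)).

Let t0 : 0 < t. Proof. exact: lt_le_trans t1. Qed.

(** The real [t] is replaced by an integer block length: being larger than [t], it makes
    [l %/ mix_block] at most the floor of l / t, and [t >= 1] keeps it below 2t. *)
Definition mix_block : nat := (Num.truncn t).+1.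

Lemma mix_block_le : mix_block%:R <= 2 * t.
Proof.
have tr : (Num.truncn t)%:R <= t by rewrite truncn_le ltW.
by rewrite /mix_block -natr1; have := t1; lra.
Qed.

Lemma kernel_iter_mix l x y : `|kernel_iter K l x y - d y| <= 2 * 2^-1 ^+ (l %/ mix_block).
Proof.
have h : tv_dist (kernel_iter K l x) d <= 2^-1 ^+ (l %/ mix_block).
  apply: le_trans (le_bigmax _ (fun x => tv_dist (kernel_iter K l x) d) x) _.
  apply: le_trans (t_mix l) _.
  rewrite exprVn exprnN ler_eXz2l ?ltr1n//.
  rewrite lerN2 floor_ge_int// -[_%:~R]/((l %/ mix_block)%:R : R) ler_pdivlMr//.
  apply: (@le_trans _ _ ((l %/ mix_block)%:R * mix_block%:R)).
    by rewrite ler_wpM2l// ltW// truncnS_gt.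
  by rewrite -natrM ler_nat leq_trunc_div.
(* One entry is bounded by the whole l1 distance, which is twice the total variation; hence the
   factor 2. *)
rewrite -ler_pdivrMl//; apply: le_trans h; rewrite /tv_dist ler_wpM2l//.
by rewrite (bigD1 y) //= lerDl sumr_ge0.
Qed.

(** Block number j contributes at most 2 * 2^-j times its length, and the geometric series sums to
    at most 4 block lengths. Uniformity in [m] is the point: the truncation can later be pushed as
    far as [alpha] demands at no cost. *)
Lemma poisson_sol_le m y x : `|poisson_sol (m * mix_block) y x| <= 8 * t.
Proof.
apply: (@le_trans _ _ (4 * mix_block%:R)); last by have := mix_block_le; lra.
apply: le_trans (ler_norm_sum _ _ _) _.
apply: (@le_trans _ _ (\sum_(i < m * mix_block) 2 * 2^-1 ^+ (i %/ mix_block))).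
  by apply: ler_sum => i _; exact: kernel_iter_mix.
suff -> : \sum_(i < m * mix_block) 2 * 2^-1 ^+ (i %/ mix_block) =
    4 * mix_block%:R * (1 - 2^-1 ^+ m) :> R.
  by rewrite ler_piMr// gerBl exprn_ge0.
elim: m => [|m IH]; first by rewrite big_ord0 expr0 subrr mulr0.
rewrite mulSn addnC big_split_ord /= IH.
rewrite (eq_bigr (fun=> 2 * 2^-1 ^+ m)); last first.
  by move=> i _; rewrite divnMDl// divn_small ?addn0.
by rewrite sumr_const card_ord -mulr_natl exprS; field.
Qed.

Lemma kernel_iter_block_mix m x y :
  `|kernel_iter K (m * mix_block) x y - d y| <= 2 * 2^-1 ^+ m.
Proof. by rewrite (le_trans (kernel_iter_mix _ _ _))// mulnK. Qed.

End TruncatedPoisson.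

(** * Q-learning *)

Section StateActionVectors.
Variables (R : realType) (nS nA : nat).
Notation S := 'I_nS.+1.
Notation A := 'I_nA.+1.
Notation N := (nS.+1 * nA.+1)%N.
Implicit Types (u v : 'cV[R]_N) (x : S * A).

Lemma sa_getD u v x : sa_get (u + v) x = sa_get u x + sa_get v x.
Proof. by rewrite /sa_get mxE. Qed.

Lemma sa_getB u v x : sa_get (u - v) x = sa_get u x - sa_get v x.
Proof. by rewrite /sa_get !mxE. Qed.

Lemma sa_getZ (c : R) u x : sa_get (c *: u) x = c * sa_get u x.
Proof. by rewrite /sa_get mxE. Qed.

Lemma sa_get_sum (I : finType) (F : I -> 'cV[R]_N) x :
  sa_get (\sum_i F i) x = \sum_i sa_get (F i) x.
Proof. by rewrite /sa_get summxE. Qed.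

Lemma sa_get_inj u v : sa_get u =1 sa_get v -> u = v.
Proof.
by move=> uv; apply/colP => i; case/mxvec_indexP: i => s a; exact: (uv (s, a)).
Qed.

Lemma sa_norm_le u (c : R) : 0 <= c -> (forall x, `|sa_get u x| <= c) -> `|u| <= c.
Proof.
move=> c0 h; apply: col_norm_le => // i; case/mxvec_indexP: i => s a.
exact: (h (s, a)).
Qed.

Lemma sa_norm_ge u x : `|sa_get u x| <= `|u|.
Proof. exact: col_norm_ge. Qed.

Lemma sum_mxvec_index (F : 'I_N -> R) :
  \sum_i F i = \sum_(x : S * A) F (mxvec_index x.1 x.2).
Proof. by rewrite (reindex _ (curry_mxvec_bij _ _)); apply: eq_bigr => -[]. Qed.

Lemma dist_average_le (I : finType) (p f : I -> R) (c : R) :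
  is_dist p -> (forall i, `|f i| <= c) -> `|\sum_i p i * f i| <= c.
Proof.
move=> [p0 p1] fc; rewrite (le_trans (ler_norm_sum _ _ _))//.
rewrite -[leRHS]mul1r -p1 big_distrl ler_sum//= => i _.
by rewrite normrM (ger0_norm (p0 i)) ler_wpM2l.
Qed.

Lemma dist_le1 (I : finType) (p : I -> R) i : is_dist p -> p i <= 1.
Proof. by move=> [p0 <-]; rewrite (bigD1 i) //= lerDl sumr_ge0. Qed.

Lemma value_ge u s a : sa_get u (s, a) <= value u s.
Proof. exact: (le_bigmax _ (fun a => sa_get u (s, a))). Qed.

Lemma value_attained u s : exists a, value u s = sa_get u (s, a).
Proof.
rewrite /value; elim/big_ind: _ => [|y z [a ->] [b ->]|a _].
- by exists ord0.
- by case: (leP (sa_get u (s, a)) (sa_get u (s, b))) => _; [exists b|exists a].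
- by exists a.
Qed.

Lemma value_norm_le u s : `|value u s| <= `|u|.
Proof. by have [a ->] := value_attained u s; exact: sa_norm_ge. Qed.

(** With [a] greedy for [u] and [b] greedy for [v], the difference of the values lies between the
    entries of [u - v] at [b] and at [a], so a mixture of these two actions realises it. A single
    action need not, which is why the convex hull appears. *)
Lemma value_sub_average u v s : exists p : A -> R, is_dist p /\
  value u s - value v s = \sum_a p a * sa_get (u - v) (s, a).
Proof.
have [a ha] := value_attained u s; have [b hb] := value_attained v s.
have := value_ge v s a; have := value_ge u s b.
set e := fun a => sa_get (u - v) (s, a).
have ea : e a = value u s - sa_get v (s, a) by rewrite /e sa_getB ha.
have eb : e b = sa_get u (s, b) - value v s by rewrite /e sa_getB hb.
set D := value u s - value v s => h1 h2.
have Da : D <= e a by rewrite ea /D lerB.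
have Db : e b <= D by rewrite eb /D lerB.
(* When the two entries coincide any weight works; 1 avoids the division by zero. *)
pose l : R := if e a == e b then 1 else (D - e b) / (e a - e b).
have [l0 l1 lD] : [/\ 0 <= l, l <= 1 & D = l * e a + (1 - l) * e b].
  rewrite /l; case: eqVneq => [ab|ab].
    by rewrite ler01 lexx; split=> //; apply/eqP; rewrite eq_le; lra.
  have lt : 0 < e a - e b by rewrite subr_gt0 lt_neqAle eq_sym ab (le_trans Db).
  split; first by rewrite divr_ge0 ?(ltW lt)// subr_ge0.
    by rewrite ler_pdivrMr// mul1r lerB.
  by field; rewrite gt_eqF.
have pick (f : A -> R) c : \sum_i (i == c)%:R * f i = f c.
  rewrite (bigD1 c) //= eqxx mul1r big1 ?addr0// => i /negPf ->; exact: mul0r.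
exists (fun i => l * (i == a)%:R + (1 - l) * (i == b)%:R); split.
  split=> [i|]; first by rewrite addr_ge0// mulr_ge0// subr_ge0.
  rewrite big_split -!big_distrr /=.
  have one c : \sum_(i : A) ((i == c)%:R : R) = 1.
    by rewrite -[RHS](pick (fun=> 1) c); apply: eq_bigr => i _; rewrite mulr1.
  by rewrite !one; ring.
rewrite lD -{1}(pick e a) -{1}(pick e b) !big_distrr -big_split /=.
by apply: eq_bigr => i _; rewrite [RHS]mulrDl !mulrA.
Qed.

Lemma value_sub_norm_le u v s : `|value u s - value v s| <= `|u - v|.
Proof.
have [p [hp ->]] := value_sub_average u v s.
by apply: dist_average_le => // a; exact: sa_norm_ge.
Qed.

End StateActionVectors.

(** * Switching matrices as mixtures over deterministic policies *)

Section SwitchingMatrices.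
Variables (R : realType) (nS nA : nat) (M : mdp R nS nA).
Variables (d : 'I_nS.+1 * 'I_nA.+1 -> R) (alpha : R).
Notation S := 'I_nS.+1.
Notation A := 'I_nA.+1.
Notation N := (nS.+1 * nA.+1)%N.
Notation gamma := (discount M).
Implicit Types (mu : S -> A -> R) (v : 'cV[R]_N) (x : S * A).

Definition policy_switch_mx mu : 'M[R]_N :=
  let D := diag_mx (sa_vec d)^T in
  1%:M - alpha *: D + (alpha * gamma) *: (D *m trans_mx M *m policy_mx mu).

Lemma policy_mx_mulE mu v s : (policy_mx mu *m v) s 0 = \sum_a mu s a * sa_get v (s, a).
Proof.
rewrite mxE sum_mxvec_index -(pair_bigA _ (fun s' a => policy_mx mu s (mxvec_index s' a)
  * v (mxvec_index s' a) 0)) /= (bigD1 s) //= [X in _ + X]big1 ?addr0.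
  apply: eq_bigr => a _; rewrite mxE -/(sa_get _ (s, a)) sa_vecK eqxx.
  by rewrite /sa_get.
move=> s' /negPf ss'; apply: big1 => a _.
by rewrite mxE -/(sa_get _ (s', a)) sa_vecK /= ss' mul0r.
Qed.

Lemma trans_mx_mulE (w : 'cV[R]_nS.+1) x :
  sa_get (trans_mx M *m w) x = \sum_s' trans M x.1 x.2 s' * w s' 0.
Proof.
rewrite /sa_get mxE; apply: eq_bigr => s' _; rewrite mxE.
by rewrite -/(sa_get _ x) sa_vecK.
Qed.

Lemma diag_sa_mulE v x : sa_get (diag_mx (sa_vec d)^T *m v) x = d x * sa_get v x.
Proof. by rewrite /sa_get mul_diag_mx mxE [_^T _ _]mxE -/(sa_get (sa_vec d) x) sa_vecK. Qed.

Lemma policy_switch_mulE mu v x : sa_get (policy_switch_mx mu *m v) x =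
  sa_get v x - alpha * (d x * sa_get v x) + alpha * gamma *
    (d x * \sum_s' trans M x.1 x.2 s' * \sum_a mu s' a * sa_get v (s', a)).
Proof.
rewrite /policy_switch_mx mulmxDl mulmxBl mul1mx -!scalemxAl -!mulmxA.
rewrite sa_getD sa_getB !sa_getZ !diag_sa_mulE trans_mx_mulE.
by congr (_ + _ * (_ * _)); apply: eq_bigr => s' _; rewrite policy_mx_mulE.
Qed.

(** Drawing the actions of all states independently gives a random deterministic policy whose
    marginal at each state is [mu]. *)
Lemma policy_mixture mu : is_policy mu ->
  let c (f : {ffun S -> A}) := \prod_s mu s (f s) in
  is_dist c /\ forall s a, \sum_(f : {ffun S -> A}) c f * deterministic R f s a = mu s a.
Proof.
move=> hmu c; split.
  split=> [f|]; first by apply: prodr_ge0 => s _; case: (hmu s).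
  by rewrite -bigA_distr_bigA big1// => s _; case: (hmu s).
(* The indicator is inserted into the factor of state [s], so that the sum over policies factorises
   into one sum per state, all but one equal to 1. *)
move=> s a; pose F s' a' := mu s' a' * (if s' == s then (a == a')%:R else 1).
transitivity (\sum_(f : {ffun S -> A}) \prod_s' F s' (f s')).
  apply: eq_bigr => f _; rewrite /F big_split /=; congr (_ * _).
  rewrite (bigD1 s) //= eqxx big1 ?mulr1// => s' /negPf ->//.
rewrite -bigA_distr_bigA (bigD1 s) //= [X in _ * X]big1 ?mulr1.
  rewrite /F eqxx (bigD1 a) //= eqxx mulr1 big1 ?addr0// => a' /negPf.
  by rewrite eq_sym => ->; rewrite mulr0.
move=> s' /negPf ss'; rewrite /F ss'.
by under eq_bigr do rewrite mulr1; case: (hmu s').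
Qed.

Lemma policy_switch_hull mu : is_policy mu ->
  convex_hull (switch_family M d alpha) (policy_switch_mx mu).
Proof.
move=> /policy_mixture; set c := fun f => _; move=> [[c0 c1] cE].
exists #|{ffun S -> A}|, (fun i => c (enum_val i)).
exists (fun i => switch_mx M d alpha (enum_val i : {ffun S -> A})).
have ev (V : nmodType) (F : {ffun S -> A} -> V) :
    \sum_(i < #|{ffun S -> A}|) F (enum_val i) = \sum_f F f.
  by rewrite [RHS](reindex _ (onW_bij _ (@enum_val_bij {ffun S -> A}))).
split; first by split=> [i|]; [exact: c0|rewrite ev].
  by move=> i; exists (enum_val i : {ffun S -> A}).
rewrite (ev _ (fun f => c f *: switch_mx M d alpha f)).
(* The switching matrix is affine in the policy matrix and the weights sum to 1, so decomposing the
   policy matrix suffices. *)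
suff pE : policy_mx mu = \sum_f c f *: policy_mx (deterministic R f).
  rewrite /policy_switch_mx /switch_mx pE mulmx_sumr scaler_sumr.
  under [RHS]eq_bigr do rewrite scalerDr scalerA (mulrC (c _)) -scalerA scalemxAr.
  by rewrite big_split /= -scaler_suml c1 scale1r.
apply/matrixP => s i; case/mxvec_indexP: i => s' a; rewrite summxE.
rewrite mxE -/(sa_get _ (s', a)) sa_vecK /=.
transitivity (\sum_f c f * (if s' == s then deterministic R f s a else 0)).
  case: eqP => _; first by rewrite cE.
  by rewrite big1// => f _; rewrite mulr0.
by apply: eq_bigr => f _; rewrite mxE mxE -/(sa_get _ (s', a)) sa_vecK.
Qed.

End SwitchingMatrices.

Section HullBounds.
Variables (R : realType) (n : nat) (H : set 'M[R]_n).

(** Convexity of the norm. The shift serves two purposes: [C = 0] transfers the contraction to the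
    hull, and a vertex [C] bounds the distance from it. *)
Lemma hull_sub_mul_le (C : 'M[R]_n) (x : 'cV[R]_n) (c : R) :
  (forall B, H B -> `|(B - C) *m x| <= c) ->
  forall B, convex_hull H B -> `|(B - C) *m x| <= c.
Proof.
move=> hc _ [m [w [V [[w0 w1] hV ->]]]].
have -> : \sum_i w i *: V i - C = \sum_i w i *: (V i - C).
  rewrite (eq_bigr _ (fun i _ => scalerBr (w i) (V i) C)) sumrB.
  by rewrite -scaler_suml w1 scale1r.
rewrite mulmx_suml (le_trans (ler_norm_sum _ _ _))//.
rewrite -[leRHS]mul1r -w1 big_distrl ler_sum//= => i _.
by rewrite -scalemxAl normrZ ger0_norm// ler_wpM2l// hc.
Qed.

Lemma hull_sub A : H A -> convex_hull H A.
Proof.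
move=> HA; exists 1%N, (fun=> 1), (fun=> A); split=> //.
  by split=> [i|]; rewrite ?big_ord1.
by rewrite big_ord1 scale1r.
Qed.

End HullBounds.

(** * Contraction and diameter of the switching family *)

Section SwitchingBounds.
Variables (R : realType) (nS nA : nat) (M : mdp R nS nA).
Variables (d : 'I_nS.+1 * 'I_nA.+1 -> R) (alpha : R).
Notation S := 'I_nS.+1.
Notation A := 'I_nA.+1.
Notation N := (nS.+1 * nA.+1)%N.
Notation gamma := (discount M).
Hypotheses (d_dist : is_dist d) (d_gt0 : forall x, 0 < d x).
Hypotheses (alpha_gt0 : 0 < alpha) (alpha_lt1 : alpha < 1).
Implicit Types (mu : S -> A -> R) (v : 'cV[R]_N) (x : S * A).

Let gamma_gt0 : 0 < gamma. Proof. exact: discount_gt0. Qed.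
Let gamma_lt1 : gamma < 1. Proof. exact: discount_lt1. Qed.
Let gamma_ge0 : 0 <= gamma. Proof. exact: ltW. Qed.
Let alpha_ge0 : 0 <= alpha. Proof. exact: ltW. Qed.

Definition gap : R := d_min d * (1 - gamma).

Lemma d_min_le x : d_min d <= d x. Proof. exact: bigmin_le. Qed.
Lemma d_max_ge x : d x <= d_max d. Proof. exact: (le_bigmax _ d). Qed.

Lemma d_min_gt0 : 0 < d_min d.
Proof. by apply: lt_bigmin => // x _; exact: d_gt0. Qed.

Lemma d_max_ge0 : 0 <= d_max d.
Proof. by apply: le_trans (d_max_ge (ord0, ord0)); exact: ltW. Qed.

Lemma gap_gt0 : 0 < gap.
Proof. by rewrite mulr_gt0 ?d_min_gt0// subr_gt0. Qed.

Lemma gap_le1 : gap <= 1.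
Proof.
have d1 := le_trans (d_min_le (ord0, ord0)) (dist_le1 (ord0, ord0) d_dist).
by apply: mulr_ile1; rewrite ?(ltW d_min_gt0) ?subr_ge0 ?(ltW gamma_lt1)// gerBl ltW.
Qed.

Lemma contraction_rate_bounds : 0 <= 1 - alpha * gap < 1.
Proof.
rewrite subr_ge0 gtrBl mulr_gt0 ?gap_gt0// andbT.
by rewrite mulr_ile1 ?gap_le1 ?(ltW gap_gt0)// ltW.
Qed.

Lemma deterministic_policy (f : S -> A) : is_policy (deterministic R f).
Proof.
move=> s; split=> [a|]; first by rewrite /deterministic.
rewrite (bigD1 (f s)) //= /deterministic eqxx big1 ?addr0// => a /negPf ->//.
Qed.

Let policy_average_le mu v x : is_policy mu ->
  `|\sum_s' trans M x.1 x.2 s' * \sum_a mu s' a * sa_get v (s', a)| <= `|v|.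
Proof.
move=> hmu; apply: dist_average_le; first exact: trans_dist.
by move=> s'; apply: dist_average_le => // a; exact: sa_norm_ge.
Qed.

(** The row of x has nonnegative entries, since alpha d(x) <= 1, with sum 1 - alpha (1 - gamma)
    d(x). *)
Lemma policy_switch_contract mu v : is_policy mu ->
  `|policy_switch_mx M d alpha mu *m v| <= (1 - alpha * gap) * `|v|.
Proof.
move=> hmu; have /andP[r0 _] := contraction_rate_bounds.
apply: sa_norm_le => [|x]; first by rewrite mulr_ge0.
rewrite policy_switch_mulE; set avg := \sum_s' _.
have ad0 : 0 <= alpha * d x by rewrite mulr_ge0// ltW.
have ad1 : alpha * d x <= 1.
  by rewrite mulr_ile1  ?(ltW (d_gt0 x)) ?dist_le1// ltW.
have -> : sa_get v x - alpha * (d x * sa_get v x) + alpha * gamma * (d x * avg) =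
    (1 - alpha * d x) * sa_get v x + (alpha * d x * gamma) * avg by ring.
rewrite (le_trans (ler_normD _ _))// !normrM.
rewrite (@ger0_norm _ (1 - _)) ?subr_ge0// (ger0_norm gamma_ge0).
rewrite -normrM (ger0_norm ad0).
apply: (@le_trans _ _ ((1 - alpha * d x) * `|v| + alpha * d x * gamma * `|v|)).
  rewrite lerD// ler_wpM2l ?subr_ge0 ?sa_norm_ge//; first by rewrite mulr_ge0.
  exact: policy_average_le.
rewrite -mulrDl ler_wpM2r// /gap.
have : alpha * (1 - gamma) * d_min d <= alpha * (1 - gamma) * d x.
  by rewrite ler_wpM2l ?d_min_le// mulr_ge0// subr_ge0 ltW.
lra.
Qed.

Lemma policy_switch_sub_le mu nu v : is_policy mu -> is_policy nu ->
  `|(policy_switch_mx M d alpha mu - policy_switch_mx M d alpha nu) *m v|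
    <= 2 * alpha * gamma * d_max d * `|v|.
Proof.
move=> hmu hnu; have dM := d_max_ge0.
apply: sa_norm_le => [|x]; first by rewrite !mulr_ge0.
rewrite mulmxBl sa_getB !policy_switch_mulE; set a1 := \sum_s' _; set a2 := \sum_s' _.
have -> : sa_get v x - alpha * (d x * sa_get v x) + alpha * gamma * (d x * a1) -
    (sa_get v x - alpha * (d x * sa_get v x) + alpha * gamma * (d x * a2)) =
    alpha * gamma * (d x * (a1 - a2)) by ring.
have h : d x * `|a1 - a2| <= d_max d * (`|v| + `|v|).
  rewrite ler_pM ?(ltW (d_gt0 x)) ?d_max_ge// (le_trans (ler_normB _ _))//.
  by rewrite lerD// policy_average_le.
have ag : 0 <= alpha * gamma by rewrite mulr_ge0.
rewrite normrM (ger0_norm ag) normrM (gtr0_norm (d_gt0 x)).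
by have := ler_wpM2l ag h; lra.
Qed.

(** Needed for summation by parts, where exchanging a vector for its image must cost only order
    [alpha]. *)
Lemma policy_switch_sub1_le mu v : is_policy mu ->
  `|v - policy_switch_mx M d alpha mu *m v| <= 2 * alpha * `|v|.
Proof.
move=> hmu; apply: sa_norm_le => [|x]; first by rewrite !mulr_ge0.
rewrite sa_getB policy_switch_mulE; set a1 := \sum_s' _.
have -> : sa_get v x - (sa_get v x - alpha * (d x * sa_get v x) +
    alpha * gamma * (d x * a1)) = alpha * (d x * (sa_get v x - gamma * a1)) by ring.
rewrite normrM (gtr0_norm alpha_gt0) normrM (gtr0_norm (d_gt0 x)).
rewrite (mulrC 2) -mulrA ler_pM2l//.
apply: (@le_trans _ _ (1 * `|sa_get v x - gamma * a1|)).
  by rewrite ler_wpM2r// dist_le1.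
rewrite mul1r (le_trans (ler_normB _ _))// mulr_natl mulr2n lerD ?sa_norm_ge//.
rewrite normrM (gtr0_norm gamma_gt0) -[leRHS]mul1r ler_pM //.
  exact: ltW.
exact: policy_average_le.
Qed.

Lemma switch_hull_contract B v : convex_hull (switch_family M d alpha) B ->
  `|B *m v| <= (1 - alpha * gap) * `|v|.
Proof.
move=> hB; rewrite -[B]subr0; apply: hull_sub_mul_le hB => _ [f _ <-].
by rewrite subr0; apply: policy_switch_contract; exact: deterministic_policy.
Qed.

Lemma switch_hull_sub_le B (f : S -> A) v : convex_hull (switch_family M d alpha) B ->
  `|(B - switch_mx M d alpha f) *m v| <= 2 * alpha * gamma * d_max d * `|v|.
Proof.
move=> hB; apply: hull_sub_mul_le hB => _ [g _ <-].
by apply: policy_switch_sub_le; exact: deterministic_policy.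
Qed.

Lemma switch_family_norm_inf B : switch_family M d alpha B ->
  norm_inf B <= 1 - alpha * gap.
Proof.
have /andP[r0 _] := contraction_rate_bounds.
by move=> hB; apply: norm_inf_le => // v; apply: switch_hull_contract; exact: hull_sub.
Qed.

End SwitchingBounds.

(** * Q-learning as a switching linear system *)

Section QLearning.
Variables (R : realType) (nS nA : nat) (M : mdp R nS nA).
Notation S := 'I_nS.+1.
Notation A := 'I_nA.+1.
Notation N := (nS.+1 * nA.+1)%N.
Notation gamma := (discount M).
Variables (alpha : R) (Q0 : 'cV[R]_N).
Hypotheses (alpha_gt0 : 0 < alpha) (alpha_lt1 : alpha < 1).
Implicit Types (p : nat -> S * A) (Q : 'cV[R]_N) (x y : S * A).

Let gamma_gt0 : 0 < gamma. Proof. exact: discount_gt0. Qed.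
Let gamma_lt1 : gamma < 1. Proof. exact: discount_lt1. Qed.
Let gamma_ge0 : 0 <= gamma. Proof. exact: ltW. Qed.
Let alpha_ge0 : 0 <= alpha. Proof. exact: ltW. Qed.

(** Radius of a ball that contains [Q0] and is invariant under the update: R_max + gamma r <= r as
    soon as r >= R_max / (1 - gamma). *)
Definition q_bound : R := Num.max `|Q0| (reward_max M / (1 - gamma)).
Definition residual_bound : R := reward_max M + (1 + gamma) * q_bound.

Definition residual Q : 'cV[R]_N := bellman M Q - Q.

Definition td_error p k : R :=
  reward M (p k).1 (p k).2 (p k.+1).1
  + gamma * value (q_iter M alpha Q0 p k) (p k.+1).1
  - sa_get (q_iter M alpha Q0 p k) (p k).

Lemma sqrt_W_max : Num.sqrt (W_max M Q0) = `|residual_bound|.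
Proof. by rewrite sqrtr_sqr. Qed.

Lemma reward_le s a s' : `|reward M s a s'| <= reward_max M.
Proof.
apply: le_trans (le_bigmax _ (fun s => \big[Num.max/0]_a \big[Num.max/0]_s' `|reward M s a s'|) s).
apply: le_trans (le_bigmax _ (fun a => \big[Num.max/0]_s' `|reward M s a s'|) a).
exact: (le_bigmax _ (fun s' => `|reward M s a s'|)).
Qed.

Lemma reward_max_ge0 : 0 <= reward_max M.
Proof. exact: le_trans (reward_le ord0 ord0 ord0). Qed.

Lemma q_bound_ge0 : 0 <= q_bound.
Proof. by rewrite le_max normr_ge0. Qed.

Lemma residual_bound_ge0 : 0 <= residual_bound.
Proof. by rewrite addr_ge0 ?reward_max_ge0// mulr_ge0 ?q_bound_ge0// addr_ge0// ltW. Qed.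

Lemma q_bound_stable : reward_max M + gamma * q_bound <= q_bound.
Proof.
have h : reward_max M / (1 - gamma) <= q_bound by rewrite le_max lexx orbT.
by move: h; rewrite ler_pdivrMr ?subr_gt0// => h; lra.
Qed.

Lemma bellmanE Q x : sa_get (bellman M Q) x =
  \sum_s' trans M x.1 x.2 s' * (reward M x.1 x.2 s' + gamma * value Q s').
Proof.
rewrite /bellman sa_getD sa_getZ sa_vecK trans_mx_mulE big_distrr -big_split /=.
by apply: eq_bigr => s' _; rewrite mxE mulrDr mulrCA.
Qed.

Lemma bellman_sub_le Q Q' : `|bellman M Q - bellman M Q'| <= gamma * `|Q - Q'|.
Proof.
apply: sa_norm_le => [|x]; first by rewrite mulr_ge0.
rewrite sa_getB !bellmanE -sumrB.
under eq_bigr do rewrite -mulrBr.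
apply: dist_average_le => [|s']; first exact: trans_dist.
rewrite opprD addrACA subrr add0r -mulrBr normrM gtr0_norm//.
by rewrite ler_pM2l// value_sub_norm_le.
Qed.

Lemma residual_sub_le Q Q' : `|residual Q - residual Q'| <= 2 * `|Q - Q'|.
Proof.
have -> : residual Q - residual Q' = (bellman M Q - bellman M Q') - (Q - Q').
  by rewrite /residual !opprB !addrA addrAC [in RHS]addrAC; apply/colP => i; rewrite !mxE; ring.
rewrite (le_trans (ler_normB _ _))// mulr_natl mulr2n lerD2r.
by rewrite (le_trans (bellman_sub_le _ _))// ler_piMl// ltW.
Qed.

Lemma q_iterS p k : q_iter M alpha Q0 p k.+1 =
  q_iter M alpha Q0 p k + alpha *: sa_vec (fun y => (p k == y)%:R * td_error p k).
Proof.
apply: sa_get_inj => y; rewrite sa_getD sa_getZ /= !sa_vecK eq_sym.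
by case: eqP => [<-|_]; rewrite ?mul1r// mul0r mulr0 addr0.
Qed.

Lemma adapted_q_iter k : adapted k (fun p => q_iter M alpha Q0 p k).
Proof.
elim: k => [|k IH] p q pq //; rewrite !q_iterS /td_error.
by rewrite (IH p q) ?(pq k) ?(pq k.+1)// => i ik; apply: pq; exact: leqW.
Qed.

Lemma adapted_td_error k : adapted k.+1 (td_error^~ k).
Proof.
move=> p q pq; rewrite /td_error (pq k.+1)// (pq k)// (adapted_q_iter (q := q))// => i ik.
by apply: pq; exact: leqW.
Qed.

Let target_le Q s a s' : `|Q| <= q_bound ->
  `|reward M s a s' + gamma * value Q s'| <= reward_max M + gamma * q_bound.
Proof.
move=> hQ; rewrite (le_trans (ler_normD _ _))// lerD ?reward_le//.
by rewrite normrM gtr0_norm// ler_pM2l// (le_trans (value_norm_le _ _)).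
Qed.

Lemma q_iter_le p k : `|q_iter M alpha Q0 p k| <= q_bound.
Proof.
elim: k => [|k IH]; first by rewrite /= le_max lexx.
apply: sa_norm_le => [|y]; first exact: q_bound_ge0.
rewrite /= sa_vecK; case: eqP => _; last by rewrite (le_trans (sa_norm_ge _ _)).
set Q := q_iter _ _ _ _ _ in IH *; set s' := (p k.+1).1.
have -> : sa_get Q y + alpha * (reward M y.1 y.2 s' + gamma * value Q s' - sa_get Q y) =
  (1 - alpha) * sa_get Q y + alpha * (reward M y.1 y.2 s' + gamma * value Q s') by ring.
have hQ := le_trans (sa_norm_ge Q y) IH.
have hT := le_trans (target_le y.1 y.2 s' IH) q_bound_stable.
rewrite (le_trans (ler_normD _ _))// !normrM gtr0_norm ?subr_gt0// (gtr0_norm alpha_gt0).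
have a1 : 0 <= 1 - alpha by rewrite subr_ge0 ltW.
have := ler_wpM2l a1 hQ; have := ler_wpM2l alpha_ge0 hT; lra.
Qed.

Lemma td_error_le p k : `|td_error p k| <= residual_bound.
Proof.
have IH := q_iter_le p k; rewrite (le_trans (ler_normB _ _))//.
have := target_le (p k).1 (p k).2 (p k.+1).1 IH.
have := le_trans (sa_norm_ge _ (p k)) IH; rewrite /residual_bound; lra.
Qed.

Lemma residual_le p k y : `|sa_get (residual (q_iter M alpha Q0 p k)) y| <= residual_bound.
Proof.
have IH := q_iter_le p k; rewrite sa_getB (le_trans (ler_normB _ _))// bellmanE.
have := dist_average_le (trans_dist M y.1 y.2) (fun s' => target_le y.1 y.2 s' IH).
have := le_trans (sa_norm_ge _ y) IH; rewrite /residual_bound; lra.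
Qed.

Lemma q_iter_increment_le p k :
  `|q_iter M alpha Q0 p k.+1 - q_iter M alpha Q0 p k| <= alpha * residual_bound.
Proof.
rewrite q_iterS addrAC subrr add0r normrZ gtr0_norm// ler_pM2l//.
apply: sa_norm_le => [|y]; first exact: residual_bound_ge0.
rewrite sa_vecK; case: eqP => _; first by rewrite mul1r td_error_le.
by rewrite mul0r normr0 residual_bound_ge0.
Qed.

Variables (d : S * A -> R) (Qstar : 'cV[R]_N).
Hypothesis Qstar_fix : bellman M Qstar = Qstar.

(** The realised update minus its mean under the stationary law. The current pair is determined by
    the past, so this is not a martingale difference. *)
Definition noise p k : 'cV[R]_N := sa_vec (fun y =>
  (p k == y)%:R * td_error p k - d y * sa_get (residual (q_iter M alpha Q0 p k)) y).

Lemma adapted_noise k : adapted k.+1 (noise^~ k).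
Proof.
move=> p q pq; rewrite /noise (adapted_td_error pq) (pq k)//.
rewrite (adapted_q_iter (q := q))// => i ik.
by apply: pq; exact: leqW.
Qed.

(* [V_Q - V_Qstar] is [Pi^mu (Q - Qstar)] for a stochastic policy [mu], so the error
   follows a switching linear system driven by the noise. *)
Lemma error_step p k : exists2 B, convex_hull (switch_family M d alpha) B &
  q_iter M alpha Q0 p k.+1 - Qstar =
  B *m (q_iter M alpha Q0 p k - Qstar) + alpha *: noise p k.
Proof.
set Q := q_iter M alpha Q0 p k.
have [mu hmu] := choice (value_sub_average Q Qstar).
exists (policy_switch_mx M d alpha mu).
  by apply: policy_switch_hull => s; case: (hmu s).
apply: sa_get_inj => y; rewrite q_iterS sa_getB !sa_getD !sa_getZ policy_switch_mulE.
rewrite /noise !sa_vecK -/Q.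
have -> : \sum_s' trans M y.1 y.2 s' * (\sum_a mu s' a * sa_get (Q - Qstar) (s', a)) =
    \sum_s' trans M y.1 y.2 s' * (value Q s' - value Qstar s').
  by apply: eq_bigr => s' _; case: (hmu s') => _ ->.
set V := \sum_s' _.
have gV : gamma * V = sa_get (bellman M Q) y - sa_get (bellman M Qstar) y.
  by rewrite !bellmanE -sumrB /V big_distrr; apply: eq_bigr => s' _ /=; ring.
rewrite Qstar_fix in gV.
have -> : sa_get (residual Q) y = gamma * V - sa_get (Q - Qstar) y.
  by rewrite gV /residual !sa_getB; ring.
rewrite sa_getB; ring.
Qed.

End QLearning.

(** * Decomposition of the Markovian noise and its response *)

Section NoiseResponse.
Variables (R : realType) (nS nA : nat) (M : mdp R nS nA).
Notation S := 'I_nS.+1.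
Notation A := 'I_nA.+1.
Notation N := (nS.+1 * nA.+1)%N.
Notation gamma := (discount M).
Variables (alpha : R) (Q0 : 'cV[R]_N) (b : S -> A -> R) (d : S * A -> R) (t : R).
Hypotheses (alpha_gt0 : 0 < alpha) (alpha_lt1 : alpha < 1) (b_policy : is_policy b).
Hypotheses (d_dist : is_dist d) (d_gt0 : forall x, 0 < d x).
Notation K := (behavior_kernel M b).
Hypothesis t_ge1 : 1 <= t.
Hypothesis t_mix : forall l : nat,
  \big[Num.max/0]_x tv_dist (kernel_iter K l x) d <= 2 ^ (- Num.floor (l%:R / t)).
Implicit Types (p : nat -> S * A) (x y : S * A).

Notation q p k := (q_iter M alpha Q0 p k).
Notation w := (residual_bound M Q0).
Notation tau := (gap M d).

Let alpha_ge0 : 0 <= alpha. Proof. exact: ltW. Qed.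
Let t_ge0 : 0 <= t. Proof. exact: le_trans t_ge1. Qed.
Let w_ge0 : 0 <= w. Proof. exact: residual_bound_ge0. Qed.

Lemma behavior_average (f : S -> R) x :
  \sum_y K x y * f y.1 = \sum_s' trans M x.1 x.2 s' * f s'.
Proof.
rewrite -(pair_bigA _ (fun s a => K x (s, a) * f s)) /=; apply: eq_bigr => s _.
rewrite /behavior_kernel /=; case: (b_policy s) => _ b1.
by rewrite -[RHS]mulr1 -b1 big_distrr; apply: eq_bigr => a _ /=; rewrite mulrAC.
Qed.

Lemma behavior_kernel_dist x : is_dist (K x).
Proof.
split=> [y|].
  by rewrite mulr_ge0//; [case: (trans_dist M x.1 x.2)|case: (b_policy y.1)].
have := behavior_average (fun=> 1) x; under eq_bigr do rewrite mulr1.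
by move=> ->; under eq_bigr do rewrite mulr1; case: (trans_dist M x.1 x.2).
Qed.

Section Decomposition.
Variable m : nat.
Hypothesis m_large : 2 * 2^-1 ^+ m <= alpha.
Let L := (m * mix_block t)%N.
Notation phi := (poisson_sol d K L).

(** Two innovations: the temporal difference minus its conditional mean, which is the residual at
    the current pair, and the Poisson solution at the next pair minus its conditional mean, weighted
    by a residual already known at time [k]. *)
Definition noise_martingale k p : 'cV[R]_N := sa_vec (fun y =>
  (p k == y)%:R * (td_error M alpha Q0 p k - sa_get (residual M (q p k)) y)
  + (phi y (p k.+1) - \sum_z K (p k) z * phi y z) * sa_get (residual M (q p k)) y).

Definition noise_potential p k : 'cV[R]_N :=
  sa_vec (fun y => phi y (p k) * sa_get (residual M (q p k)) y).

(** The telescoping term uses the residuals of two successive iterates, which differ by order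
    [alpha]; the second summand is the truncation remainder, made at most [alpha] by [m_large]. *)
Definition noise_drift p k : 'cV[R]_N := sa_vec (fun y =>
  phi y (p k.+1) * sa_get (residual M (q p k.+1) - residual M (q p k)) y
  + (kernel_iter K L (p k) y - d y) * sa_get (residual M (q p k)) y).

Lemma noiseE p k : noise M alpha Q0 d p k = noise_martingale k p
  + (noise_potential p k - noise_potential p k.+1) + noise_drift p k.
Proof.
apply: sa_get_inj => y; rewrite 2!sa_getD sa_getB !sa_vecK sa_getB.
have := poisson_solE d behavior_kernel_dist L y (p k).
set s := \sum_z _ => h.
have -> : kernel_iter K L (p k) y = (p k == y)%:R - (phi y (p k) - s).
  by rewrite h; ring.
ring.
Qed.

Let phi_le y x : `|phi y x| <= 8 * t. Proof. exact: poisson_sol_le. Qed.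

Let product_le (f g c e : R) : `|f| <= c -> `|g| <= e -> `|f * g| <= c * e.
Proof. by move=> fc ge; rewrite normrM ler_pM. Qed.

Lemma adapted_noise_martingale k : adapted k.+1 (noise_martingale k).
Proof.
move=> p p' pp'; rewrite /noise_martingale (adapted_td_error _ _ _ pp').
have -> : q p k = q p' k by apply: adapted_q_iter => i ik; apply: pp'; exact: leqW.
by rewrite (pp' k)// (pp' k.+1).
Qed.

Lemma noise_martingale_mean0 k p :
  \sum_z K (p k) z *: noise_martingale k (extend p k z) = 0.
Proof.
apply: sa_get_inj => y; rewrite sa_get_sum.
set Q := q p k; set s := \sum_z K (p k) z * phi y z.
pose T (z : S * A) := reward M (p k).1 (p k).2 z.1 + gamma * value Q z.1.
have K1 : \sum_z K (p k) z = 1 by case: (behavior_kernel_dist (p k)).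
have term z : sa_get (K (p k) z *: noise_martingale k (extend p k z)) y =
    (p k == y)%:R * (K (p k) z * T z)
    + K (p k) z * (- (p k == y)%:R * (sa_get Q (p k) + sa_get (residual M Q) y)
                   - s * sa_get (residual M Q) y)
    + sa_get (residual M Q) y * (K (p k) z * phi y z).
  rewrite sa_getZ sa_vecK /td_error extend_last extend_le//.
  rewrite (adapted_extend _ _ (adapted_q_iter M alpha Q0 (k := k))) -/Q -/s /T.
  by ring.
rewrite (eq_bigr _ (fun z _ => term z)) !big_split /= -!big_distrr -big_distrl /= K1 -/s.
(* The target depends on the next pair through its state only, so the behavior action sums out and
   the Bellman operator appears. *)
rewrite (behavior_average (fun s' => reward M (p k).1 (p k).2 s' + gamma * value Q s')).
rewrite -bellmanE; have -> : sa_get (0 : 'cV[R]_N) y = 0 by rewrite /sa_get mxE.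
by case: eqP => [->|_] /=; rewrite /residual !sa_getB; ring.
Qed.

Lemma noise_martingale_le k p : `|noise_martingale k p| <= 18 * t * w.
Proof.
apply: sa_norm_le => [|y]; first by rewrite !mulr_ge0.
have hg := residual_le M Q0 alpha_gt0 alpha_lt1 p k y.
have ht := td_error_le M Q0 alpha_gt0 alpha_lt1 p k.
set g := sa_get _ y in hg; rewrite sa_vecK -/g (le_trans (ler_normD _ _))//.
have h1 : `|(p k == y)%:R * (td_error M alpha Q0 p k - g)| <= 2 * w.
  case: eqP => _; last by rewrite mul0r normr0 mulr_ge0.
  by rewrite mul1r (le_trans (ler_normB _ _))// mulr_natl mulr2n lerD.
have h2 : `|phi y (p k.+1) - \sum_z K (p k) z * phi y z| <= 16 * t.
  rewrite (le_trans (ler_normB _ _))//.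
  have := dist_average_le (behavior_kernel_dist (p k)) (phi_le y).
  have := phi_le y (p k.+1); lra.
(* Since [t >= 1], the summand 2w is at most 2tw, and 18 = 2 + 16. *)
have h3 := product_le h2 hg; have : 0 <= (t - 1) * w by rewrite mulr_ge0// subr_ge0.
by move: h1 h3; set a := `|_|; set c := `|_|; lra.
Qed.

Lemma noise_potential_le p k : `|noise_potential p k| <= 8 * t * w.
Proof.
apply: sa_norm_le => [|y]; first by rewrite !mulr_ge0.
by rewrite sa_vecK product_le// residual_le.
Qed.

Lemma noise_drift_le p k : `|noise_drift p k| <= 17 * alpha * t * w.
Proof.
apply: sa_norm_le => [|y]; first by rewrite !mulr_ge0.
rewrite sa_vecK (le_trans (ler_normD _ _))//.
have h1 : `|sa_get (residual M (q p k.+1) - residual M (q p k)) y| <= 2 * (alpha * w).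
  rewrite (le_trans (sa_norm_ge _ _))// (le_trans (residual_sub_le _ _ _))//.
  by rewrite ler_pM2l// q_iter_increment_le.
have h2 : `|kernel_iter K L (p k) y - d y| <= alpha.
  exact: le_trans (kernel_iter_block_mix t_ge1 t_mix m (p k) y) m_large.
have h3 := product_le (phi_le y (p k.+1)) h1.
have h4 := product_le h2 (residual_le M Q0 alpha_gt0 alpha_lt1 p k y).
(* 16 comes from the change of the residual, 1 from the truncation remainder, again through
   [t >= 1]. *)
have : 0 <= (t - 1) * (alpha * w) by rewrite mulr_ge0 ?mulr_ge0// subr_ge0.
by move: h3 h4; set a := `|_|; set c := `|_|; lra.
Qed.

End Decomposition.

Variable f : S -> A.
Notation B := (switch_mx M d alpha f).

Let B_hull : convex_hull (switch_family M d alpha) B.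
Proof. by apply: hull_sub; exists f. Qed.

Let B_le (v : 'cV[R]_N) : `|B *m v| <= (1 - alpha * tau) * `|v|.
Proof. exact: switch_hull_contract. Qed.

(** Summation by parts turns the differences into inputs [psi j - B *m psi j] of order [alpha],
    which cancels the 1 / [alpha] from accumulation; the two boundary terms give the summand
    [2 * c]. *)
Lemma response_telescope_le (psi : nat -> 'cV[R]_N) c k : (forall j, `|psi j| <= c) ->
  `|response (fun=> B) (fun j => psi j - psi j.+1) k| <= 2 * c + 2 * c / tau.
Proof.
move=> hc; have c0 : 0 <= c := le_trans (normr_ge0 _) (hc 0%N).
have r01 := contraction_rate_bounds M d_dist d_gt0 alpha_gt0 alpha_lt1.
have tau0 := gap_gt0 M d_gt0.
have -> : response (fun=> B) (fun j => psi j - psi j.+1) k =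
    left_prod (fun=> B) k *m psi 0%N + response (fun=> B) (fun j => psi j - B *m psi j) k
    - psi k.
  elim: k => [|k IH] /=; first by rewrite mul1mx addr0 subrr.
  rewrite IH mulmxBr mulmxDr mulmxA.
  by apply/colP => i; rewrite !mxE; ring.
have h1 : `|left_prod (fun=> B) k *m psi 0%N| <= c.
  elim: k => [|k IH] /=; first by rewrite mul1mx.
  rewrite -mulmxA (le_trans (B_le _))//; have /andP[_ r1] := r01.
  by apply: le_trans IH; rewrite ler_piMl// ltW.
have h2 : `|response (fun=> B) (fun j => psi j - B *m psi j) k| <= 2 * c / tau.
  have -> : 2 * c / tau = 2 * alpha * c / (1 - (1 - alpha * tau)).
    by field; rewrite !gt_eqF// opprB addrCA subrr addr0 mulr_gt0.
  apply: response_le => // [|j]; first by rewrite !mulr_ge0.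
  apply: (@le_trans _ _ (2 * alpha * `|psi j|)); last by rewrite ler_wpM2l// mulr_ge0.
  apply: policy_switch_sub1_le => //; exact: deterministic_policy.
have h3 := hc k; rewrite (le_trans (ler_normB _ _))//.
have := ler_normD (left_prod (fun=> B) k *m psi 0%N)
  (response (fun=> B) (fun j => psi j - B *m psi j) k).
lra.
Qed.

Definition noise_bound : R := 128 * nS.+1%:R ^+ 2 * nA.+1%:R ^+ 2 * w *
  (t * Num.sqrt (alpha / tau) + alpha * t / tau).

Lemma noise_response_le k : path_expect d K k (fun p =>
  `|response (fun=> B) (fun j => alpha *: noise M alpha Q0 d p j) k|) <= noise_bound.
Proof.
have [m hm] : exists m, 2 * 2^-1 ^+ m <= alpha.
  have h2 : `|2^-1 : R| < 1 by rewrite gtr0_norm// invf_lt1// ltr1n.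
  have /cvgrPdist_lt := cvg_expr h2 => /(_ (alpha / 2)).
  case=> [|n _ hn]; first by rewrite divr_gt0.
  exists n; have := hn n (leqnn n); rewrite /= sub0r normrN ger0_norm ?exprn_ge0//; lra.
have tau0 := gap_gt0 M d_gt0; have tau1 := gap_le1 M d_dist d_gt0.
have r01 := contraction_rate_bounds M d_dist d_gt0 alpha_gt0 alpha_lt1.
have rE : 1 - (1 - alpha * tau) = alpha * tau by ring.
have K_dist := behavior_kernel_dist.
pose U := path_expect d K k (fun p =>
  `|response (fun=> B) (fun j => alpha *: noise_martingale m j p) k|).
pose a := alpha * t * w / tau.
have a0 : 0 <= a by rewrite divr_ge0 ?(ltW tau0)// !mulr_ge0.
have pathwise p : `|response (fun=> B) (fun j => alpha *: noise M alpha Q0 d p j) k|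
    <= `|response (fun=> B) (fun j => alpha *: noise_martingale m j p) k| + 49 * a.
  pose psi j := alpha *: noise_potential m p j.
  have -> : (fun j => alpha *: noise M alpha Q0 d p j) = (fun j =>
      (alpha *: noise_martingale m j p + (psi j - psi j.+1)) + alpha *: noise_drift m p j).
    by apply/funext => j; rewrite (noiseE m) !scalerDr scalerN.
  rewrite 2!responseD.
  (* 16 from the boundary terms, using [tau <= 1], and 16 from the accumulated inputs. *)
  have h1 : `|response (fun=> B) (fun j => psi j - psi j.+1) k| <= 32 * a.
    apply: le_trans (response_telescope_le (c := alpha * (8 * t * w)) k _) _ => [j|].
      by rewrite normrZ gtr0_norm// ler_pM2l// noise_potential_le.
    have -> : 2 * (alpha * (8 * t * w)) / tau = 16 * a by rewrite /a; field; rewrite gt_eqF.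
    have -> : 2 * (alpha * (8 * t * w)) = 16 * (a * tau) by rewrite /a; field; rewrite gt_eqF.
    have : a * tau <= a by rewrite ler_piMr.
    lra.
  have h2 : `|response (fun=> B) (fun j => alpha *: noise_drift m p j) k| <= 17 * a.
    have -> : 17 * a = alpha * (17 * alpha * t * w) / (1 - (1 - alpha * tau)).
      by rewrite rE /a; field; rewrite !gt_eqF.
    apply: response_le => // [|j]; first by rewrite !mulr_ge0.
    by rewrite normrZ gtr0_norm// ler_pM2l// noise_drift_le.
  have := ler_normD (response (fun=> B) (fun j => alpha *: noise_martingale m j p) k +
    response (fun=> B) (fun j => psi j - psi j.+1) k)
    (response (fun=> B) (fun j => alpha *: noise_drift m p j) k).
  have := ler_normD (response (fun=> B) (fun j => alpha *: noise_martingale m j p) k)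
    (response (fun=> B) (fun j => psi j - psi j.+1) k).
  lra.
have hU : U <= N%:R * (18 * t * w * Num.sqrt (alpha / tau)).
  (* The input carries a factor [alpha], and alpha^2 / (alpha tau) = alpha / tau. *)
  have -> : 18 * t * w * Num.sqrt (alpha / tau) =
      Num.sqrt ((alpha * (18 * t * w)) ^+ 2 / (1 - (1 - alpha * tau))).
    have -> : (alpha * (18 * t * w)) ^+ 2 / (1 - (1 - alpha * tau)) =
        (18 * t * w) ^+ 2 * (alpha / tau).
      by rewrite rE; field; rewrite !gt_eqF.
    by rewrite [RHS]sqrtrM ?sqr_ge0// sqrtr_sqr ger0_norm// !mulr_ge0.
  apply: (martingale_response_norm (m := fun j p => alpha *: noise_martingale m j p)) => //.
  - by move=> j p p' /adapted_noise_martingale ->.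
  - move=> j p; under eq_bigr do rewrite scalerA mulrC -scalerA.
    by rewrite -scaler_sumr noise_martingale_mean0 scaler0.
  - by move=> j p; rewrite normrZ gtr0_norm// ler_pM2l// noise_martingale_le.
apply: le_trans (path_expect_le d_dist K_dist k pathwise) _.
rewrite path_expectD (path_expect_cst d_dist K_dist) -/U /noise_bound.
set r := Num.sqrt _ in hU *; have r0 : 0 <= r := sqrtr_ge0 _.
have N1 : 1 <= N%:R :> R by rewrite ler1n muln_gt0.
have -> : 128 * nS.+1%:R ^+ 2 * nA.+1%:R ^+ 2 * w * (t * r + alpha * t / tau) =
    128 * N%:R ^+ 2 * (t * w * r + a) by rewrite /a natrM; field; rewrite gt_eqF.
have N2 : N%:R <= N%:R ^+ 2 :> R by rewrite expr2 ler_peMl// ler0n.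
have x0 : 0 <= t * w * r by rewrite !mulr_ge0.
have := ler_wpM2r x0 N2; have := ler_wpM2r a0 N2; have := ler_wpM2r a0 N1.
have := ler_wpM2r x0 N1; move: hU x0.
set n := N%:R; set xx := t * w * r.
have -> : 18 * t * w * r = 18 * xx by rewrite /xx; ring.
lra.
Qed.

End NoiseResponse.

(** * Comparison with the time-invariant system *)

Section ErrorBound.
Variables (R : realType) (nS nA : nat) (M : mdp R nS nA).
Notation S := 'I_nS.+1.
Notation A := 'I_nA.+1.
Notation N := (nS.+1 * nA.+1)%N.
Variables (alpha : R) (Q0 Qstar : 'cV[R]_N) (d : S * A -> R) (f : S -> A) (beta : R).
Hypotheses (alpha_gt0 : 0 < alpha) (alpha_lt1 : alpha < 1).
Hypotheses (d_dist : is_dist d) (d_gt0 : forall x, 0 < d x).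
Hypothesis Qstar_fix : bellman M Qstar = Qstar.
Hypothesis beta_gt : joint_spectral_radius (switch_family M d alpha) < beta.

Notation K := (growth_const (switch_family M d alpha) beta).
Notation B := (switch_mx M d alpha f).
Notation c := (2 * alpha * discount M * d_max d).
Notation u p := (response (fun=> B) (fun j => alpha *: noise M alpha Q0 d p j)).

(** The switching matrices depend on the trajectory, but the bound is linear in the norms of [u]
    with deterministic coefficients, so expectations can be taken term by term. *)
Lemma error_norm_le (p : nat -> S * A) k :
  `|q_iter M alpha Q0 p k - Qstar| <=
    `|u p k| + c * (\sum_(j < k) (1 - alpha * gap M d) ^+ (k.-1 - j) * `|u p j|)
    + (K * beta ^+ k * `|Q0 - Qstar| + c * K ^+ 2 * (k%:R * beta ^+ k.-1) * `|Q0 - Qstar|).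
Proof.
have r01 := contraction_rate_bounds M d_dist d_gt0 alpha_gt0 alpha_lt1.
have /andP[r0 _] := r01.
have H0 : switch_family M d alpha !=set0 by exists B, f.
have HL D : switch_family M d alpha D -> norm_inf D <= 1 - alpha * gap M d.
  exact: switch_family_norm_inf.
have beta0 : 0 <= beta.
  apply: le_trans (ltW beta_gt); exact: (joint_spectral_radius_ge0 H0 HL).
have growth (C : nat -> 'M[R]_N) l : (forall i, convex_hull (switch_family M d alpha) (C i)) ->
    norm_inf (left_prod C l) <= K * beta ^+ l.
  exact: (hull_prod_le_growth H0 HL).
have B_hull : convex_hull (switch_family M d alpha) B by apply: hull_sub; exists f.
have K0 : 0 <= K.
  by have := growth (fun=> B) 0%N (fun=> B_hull); rewrite expr0 mulr1; apply: le_trans;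
    exact: norm_inf_ge0.
have c0 : 0 <= c by rewrite !mulr_ge0 ?d_max_ge0// ltW// discount_gt0.
have step j : exists C, convex_hull (switch_family M d alpha) C /\
    q_iter M alpha Q0 p j.+1 - Qstar =
    C *m (q_iter M alpha Q0 p j - Qstar) + alpha *: noise M alpha Q0 d p j.
  by have [C hC eC] := error_step alpha Q0 d Qstar_fix p j; exists C.
have [C hC] := choice step.
have := response_perturb B k (fun j => (hC j).2).
set v := fun j => _ *m _; move=> -> /=.
have hv j : `|v j| <= K * `|Q0 - Qstar| * beta ^+ j.
  by rewrite mulrAC (le_trans (norm_mulmx_le _ _))// ler_wpM2r// growth.
have h1 : `|response C (fun j => (C j - B) *m v j) k| <=
    K * (c * (K * `|Q0 - Qstar|)) * (k%:R * beta ^+ k.-1).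
  apply: response_growth => // [i l|j]; first by apply: growth => j; case: (hC (j + i)%N).
  have [hCj _] := hC j; apply: le_trans (switch_hull_sub_le d_gt0 alpha_gt0 f _ hCj) _.
  by rewrite -[leRHS]mulrA ler_wpM2l.
have h2 : `|response C (fun j => (C j - B) *m u p j) k| <=
    c * (\sum_(j < k) (1 - alpha * gap M d) ^+ (k.-1 - j) * `|u p j|).
  apply: le_trans (response_norm _ _ r0 _) _ => [i x|].
    by have [hCi _] := hC i; exact: switch_hull_contract.
  rewrite big_distrr ler_sum// => j _ /=; rewrite [leRHS]mulrCA ler_wpM2l ?exprn_ge0//.
  by have [hCj _] := hC j; exact: switch_hull_sub_le.
have n1 := ler_normD (v k + u p k + response C (fun j => (C j - B) *m v j) k)
  (response C (fun j => (C j - B) *m u p j) k).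
have n2 := ler_normD (v k + u p k) (response C (fun j => (C j - B) *m v j) k).
have n3 := ler_normD (v k) (u p k).
have hk := hv k.
apply: le_trans n1 _; apply: le_trans (lerD (le_trans n2 (lerD n3 h1)) h2) _.
have -> : K * (c * (K * `|Q0 - Qstar|)) * (k%:R * beta ^+ k.-1) =
  c * K ^+ 2 * (k%:R * beta ^+ k.-1) * `|Q0 - Qstar| by ring.
rewrite mulrAC in hk.
lra.
Qed.

End ErrorBound.

Theorem theorem4 (R : realType) (nS nA : nat) (M : mdp R nS nA)
    (b : 'I_nS.+1 -> 'I_nA.+1 -> R) (hb : is_policy b)
    (alpha : R) (halpha0 : 0 < alpha) (halpha1 : alpha < 1)
    (Q0 : 'cV[R]_(nS.+1 * nA.+1))
    (Qstar : 'cV[R]_(nS.+1 * nA.+1)) (hQstar : bellman M Qstar = Qstar)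
    (d : 'I_nS.+1 * 'I_nA.+1 -> R)
    (hd : stationary (behavior_kernel M b) d) (hdpos : forall x, 0 < d x)
    (hirr : irreducible (behavior_kernel M b))
    (haper : aperiodic (behavior_kernel M b))
    (dO : measure_display) (Omega : measurableType dO) (Pr : probability Omega R)
    (X : nat -> Omega -> 'I_nS.+1 * 'I_nA.+1)
    (hX : markov_chain Pr X d (behavior_kernel M b))
    (tmix : R) (htmix1 : 1 <= tmix)
    (htmix : forall l : nat,
      \big[Num.max/0]_x tv_dist (kernel_iter (behavior_kernel M b) l x) d
        <= 2 ^ (- Num.floor (l%:R / tmix)))
    (eps : R) (heps : 0 < eps)
    (hbeta : joint_spectral_radius (switch_family M d alpha) + eps < 1)
    (k : nat) :
  let gamma := discount M in
  let beta := joint_spectral_radius (switch_family M d alpha) + eps in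
  let K := growth_const (switch_family M d alpha) beta in
  let err0 := `|Q0 - Qstar| in
  ('E_Pr[fun w => `|q_iter M alpha Q0 (X^~ w) k - Qstar|%R] <=
   ((1 + 2 * gamma * d_max d / (d_min d * (1 - gamma)))
      * (128 * nS.+1%:R ^+ 2 * nA.+1%:R ^+ 2) * Num.sqrt (W_max M Q0)
      * (tmix * Num.sqrt (alpha / (d_min d * (1 - gamma)))
         + alpha * tmix / (d_min d * (1 - gamma)))
    + K * beta ^+ k * err0
    + 2 * alpha * gamma * d_max d * K ^+ 2 * (k%:R * beta ^+ k.-1) * err0)%:E)%E.

Proof.
cbv zeta; set gamma := discount M; set beta := joint_spectral_radius _ + eps.
set K := growth_const _ _; set err0 := `|Q0 - Qstar|.
have d_dist := hd.1.
have beta_gt : joint_spectral_radius (switch_family M d alpha) < beta by rewrite ltrDl.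
have K_dist := behavior_kernel_dist M hb.
have adapted_error : adapted k (fun p => `|q_iter M alpha Q0 p k - Qstar|).
  by move=> p q pq; rewrite (adapted_q_iter M alpha Q0 pq).
rewrite (chain_expectation hX (fun=> normr_ge0 _) adapted_error) lee_fin.
(* Any deterministic policy can serve as the reference. *)
pose f : 'I_nS.+1 -> 'I_nA.+1 := fun=> ord0.
pose u p := response (fun=> switch_mx M d alpha f) (fun j => alpha *: noise M alpha Q0 d p j).
have u_le j : (j <= k)%N -> path_expect d (behavior_kernel M b) k (fun p => `|u p j|)
    <= noise_bound M alpha Q0 d tmix.
  have adapted_u : adapted j (u^~ j).
    apply: adapted_response => i p q pq.
    by rewrite (adapted_noise M alpha Q0 d pq).
  move=> jk; rewrite (path_expect_adapted d K_dist jk).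
    exact: (noise_response_le Q0 halpha0 halpha1 hb d_dist hdpos htmix1 htmix f).
  by move=> p q /adapted_u ->.
have r01 := contraction_rate_bounds M d_dist hdpos halpha0 halpha1.
have /andP[r0 _] := r01; have tau0 := gap_gt0 M hdpos.
have pathwise p := error_norm_le Q0 f halpha0 halpha1 d_dist hdpos hQstar beta_gt p k.
apply: le_trans (path_expect_le d_dist K_dist k pathwise) _.
rewrite !path_expectD !(path_expect_cst d_dist K_dist) path_expectZ path_expect_sum.
set W := noise_bound _ _ _ _ _ in u_le.
have W0 : 0 <= W.
  apply: le_trans (u_le k (leqnn k)); rewrite -(path_expect_cst d_dist K_dist k 0).
  exact: path_expect_le.
set c := 2 * alpha * _ * _.
have c0 : 0 <= c by rewrite !mulr_ge0 ?d_max_ge0// ltW// discount_gt0.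
have sum_le : \sum_(j < k) path_expect d (behavior_kernel M b) k
    (fun p => (1 - alpha * gap M d) ^+ (k.-1 - j) * `|u p j|) <= W / (alpha * gap M d).
  apply: (@le_trans _ _ (W * \sum_(j < k) (1 - alpha * gap M d) ^+ (k.-1 - j))).
    rewrite big_distrr ler_sum// => j _ /=.
    by rewrite path_expectZ mulrC ler_wpM2r ?exprn_ge0// u_le// ltnW.
  rewrite ler_wpM2l//; apply: le_trans (geometric_sum_le k r01) _.
  by rewrite opprB addrCA subrr addr0.
(* The step size in [c] cancels against the one in the accumulated contraction. *)
have -> : (1 + 2 * gamma * d_max d / (d_min d * (1 - gamma)))
      * (128 * nS.+1%:R ^+ 2 * nA.+1%:R ^+ 2) * Num.sqrt (W_max M Q0)
      * (tmix * Num.sqrt (alpha / (d_min d * (1 - gamma)))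
         + alpha * tmix / (d_min d * (1 - gamma))) = W + c * (W / (alpha * gap M d)).
  rewrite sqrt_W_max ger0_norm ?residual_bound_ge0//.
  rewrite -/gamma -/(gap M d) /c /W /noise_bound -/gamma.
  by field; rewrite !gt_eqF.
by rewrite -[leRHS]addrA lerD// lerD ?u_le// ler_wpM2l.
Qed.
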